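(* Let $j\ge1$ be an integer and $\alpha<-1$. Then there is a constant $C>0$ such that for all $f\in L^{4/3}(\mathbb{H},\mu_{\alpha,j})$ and all $\lambda>0$, $$\left|\{(z_1,z_2)\in\mathbb{H} : |P(f)(z_1,z_2)|>\lambda\}\right| \le \frac{C\,\|f\|^{4/3}_{L^{4/3}(\mathbb{H},\mu_{\alpha,j})}}{\lambda^{4/3}},$$ where $\mu_{\alpha,j}(z_1,z_2)=\left(|z_2|^{2}f_{\alpha,j}(z_2)\right)^{-1/3}$.
   Context: $\mathbb{H}=\{(z_1,z_2)\in\mathbb{C}^2:|z_1|<|z_2|<1\}$, $dV$ Lebesgue measure, $|U|$ Lebesgue measure of $U$. The Bergman projection is $P(f)(z)=\int_{\mathbb{H}}K_{\mathbb{H}}(z;\bar w)f(w)\,dV(w)$, $K_{\mathbb{H}}(z_1,z_2;\bar w_1,\bar w_2)=\frac{1}{\pi^2 z_2\bar w_2(1-\frac{z_1\bar w_1}{z_2\bar w_2})^2(1-z_2\bar w_2)^2}$. For a positive weight $\mu$, $\|f\|^p_{L^p(\mathbb{H},\mu)}=\int_{\mathbb{H}}|f|^p\mu\,dV$. For $z\in\mathbb{D}\setminus\{0\}$ define $h_1(z)=-\log|z|+1$ and $h_{k+1}(z)=\log(h_k(z)+1)+1$ for $k\ge1$, and $f_{\alpha,j}(z)=|z|^{-2}h_j(z)^{\alpha}\prod_{k=1}^{j-1}h_k(z)^{-1}$ (empty product equal to $1$). *)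

(* Defs.v *)
From HB Require Import structures.
From mathcomp Require Import all_boot all_order all_algebra.
From mathcomp Require Import all_classical all_reals all_analysis.
From mathcomp Require Import complex.
Import Order.TTheory GRing.Theory Num.Theory.
Import ComplexField Normc.
Local Open Scope ring_scope.
Local Open Scope classical_set_scope.
Local Open Scope complex_scope.

(* Lebesgue measure on C = R^2 and on C^2 = R^4 *)
(* the measurable space R with its Lebesgue sigma-algebra *)
Notation RL R := (measurableTypeR R).
(* a point (z1, z2) = (x1 + i y1, x2 + i y2) of C^2 = R^4 is encoded as
   (((x1, y1), x2), y2) *)
Notation C2 R := (((RL R * RL R) * RL R) * RL R)%type.

(* Lebesgue measure on C^2 = R^4: product of four copies of Lebesgue measure on R *)
Definition vol4 (R : realType) : {measure set (C2 R) -> \bar R} :=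
  (((@lebesgue_measure R \x @lebesgue_measure R) \x @lebesgue_measure R)
     \x @lebesgue_measure R)%E.

Definition z1 (R : realType) (v : C2 R) : R[i] := v.1.1.1 +i* v.1.1.2.
Definition z2 (R : realType) (v : C2 R) : R[i] := v.1.2 +i* v.2.

(* the Hartogs triangle H = {|z1| < |z2| < 1} *)
Definition Hartogs (R : realType) : set (C2 R) :=
  [set v | normc (z1 R v) < normc (z2 R v) < 1].

(* Bergman kernel K_H(z; conj w) *)
Definition bergman_kernel (R : realType) (z w : C2 R) : R[i] :=
  ((pi ^+ 2)%:C * z2 R z * (z2 R w)^*
     * (1 - z1 R z * (z1 R w)^* / (z2 R z * (z2 R w)^*)) ^+ 2
     * (1 - z2 R z * (z2 R w)^*) ^+ 2)^-1.

(* integral of a complex-valued function: real part + i imaginary part *)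
Definition cintegral (R : realType) (D : set (C2 R))
    (F : C2 R -> R[i]) : R[i] :=
  Rintegral (vol4 R) D (fun w => complex.Re (F w)) +i* Rintegral (vol4 R) D (fun w => complex.Im (F w)).

(* Bergman projection P(f)(z) = int_H K(z; conj w) f(w) dV(w) *)
Definition bergman_proj (R : realType) (f : C2 R -> R[i])
    (z : C2 R) : R[i] :=
  cintegral R (Hartogs R) (fun w => bergman_kernel R z w * f w).

(* h_k(z), k >= 1 (paper's indexing; the value at k = 0 is irrelevant) *)
Fixpoint hfun (R : realType) (k : nat) (z : R[i]) : R :=
  match k with
  | 0 => 0
  | k'.+1 => match k' with
             | 0 => - ln (normc z) + 1
             | _ => ln (hfun R k' z + 1) + 1
             end
  end.

(* f_{alpha,j}(z) = |z|^{-2} h_j(z)^alpha prod_{k=1}^{j-1} h_k(z)^{-1} *)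
Definition falpha (R : realType) (alpha : R) (j : nat) (z : R[i]) : R :=
  (normc z ^+ 2)^-1 * (hfun R j z `^ alpha) * \prod_(1 <= k < j) (hfun R k z)^-1.

(* mu_{alpha,j}(z1,z2) = (|z2|^2 f_{alpha,j}(z2))^{-1/3} *)
Definition mu_weight (R : realType) (alpha : R) (j : nat)
    (v : C2 R) : R :=
  (normc (z2 R v) ^+ 2 * falpha R alpha j (z2 R v)) `^ (- (1 / 3%:R)).

(* ||f||^{4/3}_{L^{4/3}(H, mu)} (extended real) *)
Definition wnorm43 (R : realType) (alpha : R) (j : nat)
    (f : C2 R -> R[i]) : \bar R :=
  (\int[vol4 R]_(w in Hartogs R)
     ((normc (f w)) `^ (4%:R / 3%:R) * mu_weight R alpha j w)%:E)%E.

(* Main.v *)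
(** The estimate holds in the strong form, by Schur's test.  With
    [t = z1 / z2], [s = w1 / w2], the kernel is
    [1 / (pi^2 z2 w2^* (1 - t s^* )^2 (1 - z2 w2^* )^2)], and on the unit disc
    [|1 - t s^*|] dominates [(1 - |t|) + (1 - |s|) + |t - s|].  The test
    functions are [G_b(w) = |w2|^-1 (1 - |s|)^-b (1 - |w2|)^-b] with [b = 1/2]
    and [b = 1/6], and [U = G_(1/2) f_(alpha,j)(w2)].  Two facts make the test
    work: [f_(alpha,j)] is integrable at the origin, because [alpha < -1] and
    [r f_(alpha,j)(r)] is comparable to the derivative of [- h_j^(alpha + 1)]
    up to a constant, so that [|K|] maps [U] to [O(G_(1/2))]; and
    [U^(-1/3) G_(1/6)] is exactly the weight [mu_(alpha,j)].  Since only the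
    weak type is needed, Hoelder's inequality is replaced by the pointwise
    bound [x <= c + c^(-1/3) x^(4/3)]. *)

(* The factor [|w2|^-1] in [G_b] balances the fibres. Integrating [w1] over the disc [|w1| < |w2|]
   brings an area of order [|w2|^2], which cancels the [|w2|^-1] of the kernel and that of [G_b];
   what remains in [w2] is the integral of the extra factor over the unit disc. With the extra
   factor 1 the same test would give the weight [|w2|^(-2/3)]. Taking [f_(alpha,j)] of size
   [|w2|^-2] up to logarithms, at the borderline of integrability in the plane, leaves only
   logarithms in [mu_(alpha,j)]. The exponent 1/6 is a third of 1/2, so that the boundary factors
   cancel in [U^(-1/3) G_(1/6)]. The planar integrals are estimated in Cartesian coordinates. The
   disc is covered by the sectors [|y| <= |x|] and [|x| <= |y|]; on each, the integrand is dominated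
   by one whose iterated integral is bounded through explicit primitives. All constants are
   therefore explicit, and crude. *)
Require Import Defs.
From HB Require Import structures.
From mathcomp Require Import all_boot all_order all_algebra.
From mathcomp Require Import all_classical all_reals all_analysis.
From mathcomp Require Import measurable_realfun complex ring lra.
Import Order.TTheory GRing.Theory Num.Theory.
Import ComplexField Normc numFieldNormedType.Exports.
Local Open Scope ring_scope.
Local Open Scope classical_set_scope.

(** * Sigma-finite products *)

Section sigma_finite_product.
Local Open Scope ereal_scope.
Context d1 d2 (T1 : measurableType d1) (T2 : measurableType d2) (R : realType).
Variable m1 : {sigma_finite_measure set T1 -> \bar R}.
Variable m2 : {sigma_finite_measure set T2 -> \bar R}.

(* The library's sigma-finite instance on [m1 \x m2] is shadowed by the one for
   subprobabilities; this alias makes it available again. *)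
Definition prodm : set (T1 * T2) -> \bar R := m1 \x m2.

HB.instance Definition _ := Measure.copy prodm (m1 \x m2).

Lemma sigma_finite_prodm : sigma_finite setT prodm.
Proof.
have /sigma_finiteP[F [TF ndF Foo]] := sigma_finiteT m1.
have /sigma_finiteP[G [TG ndG Goo]] := sigma_finiteT m2.
exists (fun n => F n `*` G n).
  apply/seteqP; split => // -[x y] _.
  have [n _ Fx] : (\bigcup_i F i) x by rewrite -TF.
  have [k _ Gy] : (\bigcup_i G i) y by rewrite -TG.
  exists (maxn n k) => //; split => /=.
    by move: x Fx; exact/subsetPset/ndF/leq_maxl.
  by move: y Gy; exact/subsetPset/ndG/leq_maxr.
move=> k; have [mF Fk] := Foo k; have [mG Gk] := Goo k.
split; first exact: measurableX.
by rewrite /prodm product_measure1E// lte_mul_pinfty// ge0_fin_numE.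
Qed.

HB.instance Definition _ := Measure_isSigmaFinite.Build _ _ _ prodm sigma_finite_prodm.

End sigma_finite_product.

Arguments prodm {d1 d2 T1 T2 R} m1 m2 _.

(** * Integrals bounded by a primitive *)

(** The integral of a nonnegative function is a supremum over the simple functions below it, so
    monotonicity needs no measurability. The comparisons below can thus be purely pointwise. *)
Lemma le_lower_integral d (T : measurableType d) (R : realType)
    (mu : {measure set T -> \bar R}) (D : set T) (f g : T -> \bar R) :
  (forall x, D x -> 0 <= f x)%E -> (forall x, D x -> f x <= g x)%E ->
  (\int[mu]_(x in D) f x <= \int[mu]_(x in D) g x)%E.
Proof.
move=> f0 fg.
have g0 x : D x -> (0 <= g x)%E by move=> Dx; rewrite (le_trans (f0 x Dx))// fg.
rewrite (integral_mkcond D f) (integral_mkcond D g) !ge0_integralTE; first last.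
- by move=> x; apply: erestrict_ge0.
- by move=> x; apply: erestrict_ge0.
apply: ereal_sup_le => _ [h hf <-]; exists h => // x.
apply: (le_trans (hf x)); rewrite !patchE; case: ifPn => //.
by rewrite inE; exact: fg.
Qed.

(** The fundamental theorem of calculus on compact subintervals, followed by monotone convergence.
    Only bounds on the primitive are asked for, so the integrand may blow up at both endpoints. *)
Lemma integral_le_primitive (R : realType) (a b m M : R) (F F' : R -> R) :
  m <= M ->
  (forall x : R, a < x < b -> is_derive x (1:R) F (F' x)) ->
  (forall x : R, a < x < b -> {for x, continuous F'}) ->
  (forall x, a < x < b -> 0 <= F' x) ->
  (forall x, a < x < b -> m <= F x <= M) ->
  (\int[@lebesgue_measure R]_(x in `]a, b[) (F' x)%:E <= (M - m)%:E)%E.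
Proof.
move=> mM dF cF' F'0 Fb.
have M0 : (0 <= (M - m)%:E :> \bar R)%E by rewrite lee_fin subr_ge0.
have mF' : measurable_fun `]a, b[ F'.
  apply: open_continuous_measurable_fun; first exact: interval_open.
  by move=> x; rewrite inE/= in_itv/=; exact: cF'.
pose e n : R := n.+1%:R^-1.
pose S n := `[a + e n, b - e n].
have e0 n : 0 < e n by rewrite invr_gt0.
have SE n x : S n x = (a + e n <= x <= b - e n) :> Prop by rewrite /S /= in_itv.
have IE x : `]a, b[ x = (a < x < b) :> Prop by rewrite /= in_itv.
have Sab n : S n `<=` `]a, b[.
  move=> x; rewrite SE IE => /andP[ax xb].
  by rewrite (lt_le_trans _ ax) ?ltrDl//= (le_lt_trans xb)// gtrDl oppr_lt0.
have -> : `]a, b[ = \bigcup_n S n.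
  apply/seteqP; split => [x|x [n _ /Sab]//].
  rewrite IE => /andP[ax xb].
  have d0 : 0 < Num.min (x - a) (b - x) by rewrite lt_min !subr_gt0 ax.
  have [n /= ne] : exists n, e n < Num.min (x - a) (b - x).
    have [k _ Hk] := near_infty_natSinv_lt (PosNum d0).
    by exists k; apply: (Hk k) => /=.
  move: ne; rewrite lt_min => /andP[n1 n2].
  by exists n => //; rewrite SE; apply/andP; split; lra.
have ndS : nondecreasing_seq S.
  move=> p q pq; rewrite subsetEset => x; rewrite !SE => /andP[ax xb].
  have epq : e q <= e p by rewrite lef_pV2 ?posrE// ler_nat ltnS.
  by apply/andP; split; lra.
have mS n : measurable (S n) by exact: measurable_itv.
apply: (cvge_le (f := fun n => (\int[@lebesgue_measure R]_(x in S n) (F' x)%:E)%E)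
   (F := \oo)); last first.
  apply: ge0_nondecreasing_set_cvg_integral => //.
  - by move=> i; apply/measurable_EFinP; apply: measurable_funS (Sab i) _.
  - by move=> i x /Sab; rewrite IE lee_fin => /F'0.
apply: nearW => n.
(* For small [n] the truncated interval can be empty or a single point; its integral is then 0 and
   [m <= M] suffices. *)
have [ab|ba] := ltP (a + e n) (b - e n); last first.
  have [ab|ab] := eqVneq (a + e n) (b - e n).
    by rewrite /S ab set_itv1 integral_set1.
  by rewrite /S set_itv_ge ?integral_set0// bnd_simp -ltNge lt_neqAle eq_sym ab.
have H x : x \in `[a + e n, b - e n]%R -> a < x < b.
  by move=> xx; have := Sab n x xx; rewrite IE.
have Ho x : x \in `]a + e n, b - e n[%R -> a < x < b.
  by move=> /subset_itv_oo_cc /H.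
have cF : {within `[a + e n, b - e n], continuous F}.
  apply: derivable_within_continuous => x xx.
  by have [] := dF x (H _ xx).
rewrite (@continuous_FTC2 _ F' F)//.
- rewrite -EFinB lee_fin.
  have /Fb/andP[? _] : a < a + e n < b by apply: H; rewrite in_itv/= lexx ltW.
  have /Fb/andP[_ ?] : a < b - e n < b by apply: H; rewrite in_itv/= lexx andbT ltW.
  lra.
- apply: continuous_in_subspaceT => x; rewrite inE => /H; exact: cF'.
- have [_ cL cR] := (continuous_within_itvP F ab).1 cF.
  by split => // x xx; have [] := dF x (Ho _ xx).
- by move=> x xx; rewrite derive1E; have [_] := dF x (Ho _ xx).
Qed.

(** * One-dimensional kernels *)

Lemma ger0_lepowRN (R : realType) (a x y : R) :
  0 <= a -> 0 < x -> x <= y -> y `^ (- a) <= x `^ (- a).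
Proof.
move=> a0 x0 xy; have y0 := lt_le_trans x0 xy.
rewrite !powRN lef_pV2 ?posrE ?powR_gt0//.
by apply: ge0_ler_powR => //; rewrite nnegrE ltW.
Qed.

Lemma is_derive_powR_comp (R : realType) (f : R -> R) (x a df : R) :
  0 < f x -> is_derive x (1:R) f df ->
  is_derive x (1:R) (fun y => f y `^ a) (a * f x `^ (a - 1) * df).
Proof.
move=> fx0 dF.
exact: is_derive1_comp (is_derive1_powR a fx0) dF.
Qed.

Lemma is_derive_shift (R : realType) (c x : R) :
  is_derive x (1:R) (fun y : R => c + y) 1.
Proof.
by apply: (is_derive_eq (is_deriveD (is_derive_cst c x 1) (is_derive_id x 1)));
   rewrite add0r.
Qed.

Lemma is_derive_reflect (R : realType) (c x : R) :
  is_derive x (1:R) (fun y : R => c - y) (-1).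
Proof.
by apply: (is_derive_eq (is_deriveB (is_derive_cst c x 1) (is_derive_id x 1)));
   rewrite add0r.
Qed.

Lemma continuous_powR (R : realType) (x a : R) :
  0 < x -> {for x, continuous (fun y : R => y `^ a)}.
Proof.
move=> x0; have [H _] := is_derive1_powR a x0.
by apply: differentiable_continuous; apply/derivable1_diffP.
Qed.

(** Put [u = b - |x|] and [q(u) = u / (B + u)], whose derivative is [B / (B + u)^2]. Since
    [B q(u) <= u], the integrand is at most [B^-(1+a) q^-a] times that derivative, with primitive
    [B^-(1+a) q^(1-a) / (1 - a)]. As [0 <= q <= 1], the bound does not depend on [b]. *)
Lemma integral_interval_kernel (R : realType) (a B b : R) :
  0 < a -> a < 1 -> 0 < B -> 0 <= b ->
  (\int[@lebesgue_measure R]_(x in `](- b)%R, b[)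
     ((b - `|x|) `^ (- a) * (B + (b - `|x|)) ^- 2)%:E
     <= (2 * (1 - a)^-1 * B `^ (- (1 + a)))%:E)%E.
Proof.
move=> a0 a1 B0 b0.
pose q (u : R) := u / (B + u).
pose g (u : R) := q u `^ (- a) * (B / (B + u) ^+ 2).
pose G (u : R) := q u `^ (1 - a).
have q0 (u : R) : 0 < u -> 0 < q u by move=> u0; rewrite divr_gt0 ?addr_gt0.
have q1 (u : R) : 0 < u -> q u <= 1.
  by move=> u0; rewrite ler_pdivrMr ?addr_gt0// mul1r lerDr ltW.
have dq (u : R) : 0 < u -> is_derive u (1:R) q (B / (B + u) ^+ 2).
  move=> u0; have Bu : B + u != 0 by rewrite gt_eqF ?addr_gt0.
  have D1 : is_derive u (1:R) (fun u => B + u) (1:R) by exact: is_derive_shift.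
  have D2 : is_derive u (1:R) (fun u : R => (B + u)^-1) _ := is_deriveV Bu D1.
  have -> : q = (id \* (fun u => (B + u)^-1)) by [].
  apply: (is_derive_eq (is_deriveM (is_derive_id u 1) D2)).
  rewrite /GRing.scale/= mulr1.
  by field.
have dG (u : R) : 0 < u -> is_derive u (1:R) G ((1 - a) * g u).
  move=> u0; have := dq _ u0; move=> /(is_derive_powR_comp _ _ _ (1 - a)) H.
  apply: is_derive_eq (H (q0 _ u0)) _.
  rewrite /g (_ : 1 - a - 1 = - a); last by ring.
  by ring.
have cg (u : R) : 0 < u -> {for u, continuous g}.
  move=> u0; have Bu : B + u != 0 by rewrite gt_eqF ?addr_gt0.
  apply: continuousM.
    apply: (@continuous_comp _ _ _ q (fun y => y `^ (- a))).
      have [H _] := dq _ u0.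
      by apply: differentiable_continuous; apply/derivable1_diffP.
    exact: (continuous_powR _ _ _ (q0 _ u0)).
  apply: continuousM; first exact: cvg_cst.
  apply: continuousV; first by rewrite expf_neq0.
  apply: (@continuous_comp _ _ _ (fun y => B + y) (fun y => y ^+ 2)).
    by apply: cvgD; [exact: cvg_cst|exact: cvg_id].
  exact: exprn_continuous.
have g0 (u : R) : 0 < u -> 0 <= g u.
  by move=> u0; rewrite mulr_ge0 ?powR_ge0// divr_ge0 ?sqr_ge0// ltW.
have G01 (u : R) : 0 < u -> 0 <= G u <= 1.
  move=> u0; rewrite powR_ge0/= [leRHS](_ : _ = 1 `^ (1 - a)); last by rewrite powR1.
  apply: ge0_ler_powR; rewrite ?nnegrE ?subr_ge0 ?q1//; last exact: ltW (q0 _ u0).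
  exact: ltW.
pose k := B `^ (- (1 + a)).
have k0 : 0 < k by exact: powR_gt0.
have fg (u : R) : 0 < u -> u `^ (- a) * (B + u) ^- 2 <= k * g u.
  move=> u0; rewrite /g /k mulrA opprD powRD; last by rewrite (gt_eqF B0) implybT.
  rewrite (powR_inv1 (ltW B0)) [B^-1 * _]mulrC.
  rewrite [leRHS](_ : _ = B `^ (- a) * (q u `^ (- a)) * (B + u) ^- 2); last first.
    by field; rewrite (gt_eqF B0) gt_eqF ?addr_gt0.
  apply: ler_wpM2r; first by rewrite invr_ge0 sqr_ge0.
  rewrite -(powRM _ (ltW B0) (ltW (q0 _ u0))).
  apply: ger0_lepowRN; [exact: ltW|by rewrite mulr_gt0// q0|].
  by rewrite mulrA ler_pdivrMr ?addr_gt0// mulrDr [u * B]mulrC lerDl mulr_ge0// ltW.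
(* [b - |x|] is one of [b + x] and [b - x]. Adding the two values of [g] gives a majorant that is
   smooth across 0, with a single primitive on the whole interval. *)
pose F x := k * (1 - a)^-1 * (G (b + x) - G (b - x)).
pose F' x := k * (g (b + x) + g (b - x)).
have xb (x : R) : - b < x < b -> 0 < b + x /\ 0 < b - x.
  by move=> /andP[? ?]; split; lra.
apply: (@le_trans _ _ (\int[@lebesgue_measure R]_(x in `](- b)%R, b[) (F' x)%:E)%E).
  apply: le_lower_integral => x; rewrite /= in_itv/= => /[dup] /xb[x1 x2] /andP[x3 x4].
    by rewrite lee_fin mulr_ge0 ?powR_ge0// invr_ge0 sqr_ge0.
  rewrite lee_fin /F' mulrDr.
  have [x0|x0] := leP 0 x.
    rewrite ger0_norm//; apply: (le_trans (fg _ x2)).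
    by rewrite lerDr mulr_ge0 ?g0// ltW.
  rewrite ltr0_norm// opprK; apply: (le_trans (fg _ x1)).
  by rewrite lerDl mulr_ge0 ?g0// ltW.
rewrite [leRHS](_ : _ = (k * (1 - a)^-1 - (- (k * (1 - a)^-1)))%:E); last first.
  by congr (_%:E); rewrite /k; ring.
have ka0 : 0 <= k * (1 - a)^-1 by rewrite mulr_ge0 ?ltW// invr_gt0 subr_gt0.
apply: integral_le_primitive.
- by lra.
- move=> x /xb[x1 x2].
  have D1 := dG _ x1; have D2 := dG _ x2.
  have E1 : is_derive x (1:R) (fun x => b + x) (1:R) by exact: is_derive_shift.
  have E2 : is_derive x (1:R) (fun x => b - x) (-1:R) by exact: is_derive_reflect.
  have H1 : is_derive x (1:R) (fun x => G (b + x)) _ := is_derive1_comp (f := G) (g := fun x => b + x) D1 E1.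
  have H2 : is_derive x (1:R) (fun x => G (b - x)) _ := is_derive1_comp (f := G) (g := fun x => b - x) D2 E2.
  apply: (is_derive_eq (is_deriveZ (k * (1 - a)^-1) (is_deriveB H1 H2))).
  rewrite /F' /GRing.scale/=.
  have : 1 - a != 0 by rewrite gt_eqF// subr_gt0.
  by move=> ?; field.
- move=> x /xb[x1 x2]; apply: continuousM; first exact: cvg_cst.
  apply: continuousD.
    apply: (@continuous_comp _ _ _ (fun y => b + y) g); last exact: cg.
    by apply: cvgD; [exact: cvg_cst|exact: cvg_id].
  apply: (@continuous_comp _ _ _ (fun y => b - y) g); last exact: cg.
  by apply: cvgB; [exact: cvg_cst|exact: cvg_id].
- by move=> x /xb[x1 x2]; rewrite mulr_ge0 ?addr_ge0 ?g0// ltW.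
- move=> x /xb[x1 x2]; rewrite /F.
  have /andP[p1 p2] := G01 _ x1; have /andP[p3 p4] := G01 _ x2.
  have uv : -1 <= G (b + x) - G (b - x) <= 1 by apply/andP; split; lra.
  by rewrite -ler_norml normrM (ger0_norm ka0) -[leRHS]mulr1 ler_wpM2l// ler_norml.
Qed.

(** On each side of [t] a primitive is, up to sign, [a^-1 (A + |y - t|)^-a], which is bounded by its
    value at [t]; this makes the bound uniform in [r] and [t]. *)
Lemma integral_line_kernel (R : realType) (a A t r : R) :
  0 < a -> 0 < A ->
  (\int[@lebesgue_measure R]_(y in `](- r)%R, r[) ((A + `|y - t|) `^ (- (1 + a)))%:E
     <= (2 * a^-1 * A `^ (- a))%:E)%E.
Proof.
move=> a0 A0.
pose f (y : R) := (A + `|y - t|) `^ (- (1 + a)).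
have f0 (y : R) : (0 <= (f y)%:E)%E by rewrite lee_fin powR_ge0.
have mf D : measurable_fun D (fun y => (f y)%:E).
  apply/measurable_EFinP; apply/(measurable_funS _ (subsetT _)) => //.
  apply: (measurableT_comp (f := fun y : R => y `^ (- (1 + a)))).
    exact: measurable_powR.
  apply: measurable_funD => //.
  by apply: measurableT_comp => //; exact: measurable_funB.
(* The interval of radius [r + |t|] about [t] contains the given one, and splitting it at [t]
   removes the absolute value. *)
pose N := r + `|t|.
have sub : `]- r, r[ `<=` `]t - N, t] `|` `]t, t + N[.
  move=> y; rewrite /= !in_itv/= => /andP[y1 y2].
  have := ler_norm t; have := ler_norm (- t); rewrite normrN /N => ? ?.
  have [|] := leP y t; [left|right]; apply/andP; split; lra.
apply: (@le_trans _ _ (\int[@lebesgue_measure R]_(y in `](t - N)%R, t] `|` `]t, (t + N)%R[)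
   (f y)%:E)%E).
  apply: ge0_subset_integral; [exact: measurable_itv| |exact: mf|by move=> y _; exact: f0|exact: sub].
  by apply: measurableU; exact: measurable_itv.
have dis : [disjoint `]t - N, t] & `]t, t + N[].
  rewrite disj_set2E; apply/eqP/seteqP; split => // y [] /=.
  by rewrite !in_itv/= => /andP[_ yt] /andP[ty _]; have := lt_le_trans ty yt; rewrite ltxx.
rewrite ge0_integral_setU; [|exact: measurable_itv|exact: measurable_itv|exact: mf
  |by move=> y _; exact: f0|exact: dis].
have C0 : 0 <= a^-1 * A `^ (- a) by rewrite mulr_ge0 ?powR_ge0// invr_ge0 ltW.
have Fb (v : R) : 0 < v -> 0 <= a^-1 * (A + v) `^ (- a) <= a^-1 * A `^ (- a).
  move=> v0; rewrite mulr_ge0 ?powR_ge0 ?invr_ge0//=; last exact: ltW.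
  rewrite ler_wpM2l ?invr_ge0//; first exact: ltW.
  by apply: ger0_lepowRN => //; rewrite ?lerDl; exact: ltW.
have dP (v : R) : 0 < v -> is_derive v (1:R) (fun v => a^-1 * (A + v) `^ (- a))
                 (- (A + v) `^ (- (1 + a))).
  move=> v0.
  have D1 : is_derive v (1:R) (fun u => A + u) (1:R) by exact: is_derive_shift.
  have Av : 0 < A + v by rewrite addr_gt0.
  have D2 := is_derive_powR_comp _ (fun u => A + u) v (- a) _ Av D1.
  apply: (is_derive_eq (is_deriveZ a^-1 D2)); rewrite /GRing.scale/= (_ : - (1 + a) = - a - 1); last by ring.
  by field; rewrite gt_eqF.
have cP (v : R) : 0 < v -> {for v, continuous (fun v => (A + v) `^ (- (1 + a)))}.
  move=> v0; apply: (@continuous_comp _ _ _ (fun y => A + y) (fun y => y `^ (- (1 + a)))).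
    by apply: cvgD; [exact: cvg_cst|exact: cvg_id].
  by apply: continuous_powR; rewrite addr_gt0.
rewrite [leRHS](_ : _ = (a^-1 * A `^ (- a))%:E + (a^-1 * A `^ (- a))%:E)%E; last first.
  by rewrite -EFinD; congr (_%:E); ring.
apply: leeD.
  rewrite -integral_itv_bndo_bndc; last exact: mf.
  apply: (@le_trans _ _ (\int[@lebesgue_measure R]_(y in `](t - N)%R, t[)
     ((A + (t - y)) `^ (- (1 + a)))%:E)%E).
    apply: le_lower_integral => [y _|y]; first exact: f0.
    rewrite /= in_itv/= => /andP[_ yt].
    by rewrite /f distrC gtr0_norm// subr_gt0.
  rewrite -[leRHS](_ : (a^-1 * A `^ (- a) - 0)%:E = _)%E; last by rewrite subr0.
  apply: (integral_le_primitive _ _ _ _ _ (fun y => a^-1 * (A + (t - y)) `^ (- a))) => //.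
  - move=> y /andP[_ yt]; have ty : 0 < t - y by rewrite subr_gt0.
    have D2 := dP _ ty.
    have E2 : is_derive y (1:R) (fun x => t - x) (-1:R) by exact: is_derive_reflect.
    have H2 : is_derive y (1:R) (fun y => a^-1 * (A + (t - y)) `^ (- a)) _ :=
      is_derive1_comp (f := fun v => a^-1 * (A + v) `^ (- a)) (g := fun x => t - x) D2 E2.
    by apply: is_derive_eq H2 _; rewrite mulrN1 opprK.
  - move=> y /andP[_ yt]; have ty : 0 < t - y by rewrite subr_gt0.
    apply: (@continuous_comp _ _ _ (fun y : R => t - y) (fun v : R => (A + v) `^ (- (1 + a)))); last exact: cP.
    by apply: cvgB; [exact: cvg_cst|exact: cvg_id].
  - by move=> y _; exact: powR_ge0.
  - by move=> y /andP[_ yt]; apply: Fb; rewrite subr_gt0.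
apply: (@le_trans _ _ (\int[@lebesgue_measure R]_(y in `]t, (t + N)%R[)
   ((A + (y - t)) `^ (- (1 + a)))%:E)%E).
  apply: le_lower_integral => [y _|y]; first exact: f0.
  rewrite /= in_itv/= => /andP[yt _].
  by rewrite /f gtr0_norm// subr_gt0.
rewrite -[leRHS](_ : (0 - (- (a^-1 * A `^ (- a))))%:E = _)%E; last by rewrite sub0r opprK.
apply: (integral_le_primitive _ _ _ _ _ (fun y => - (a^-1 * (A + (y - t)) `^ (- a)))) => //.
- by rewrite oppr_le0.
- move=> y /andP[yt _]; have ty : 0 < y - t by rewrite subr_gt0.
  have D2 := dP _ ty.
  have E2 : is_derive y (1:R) (fun x => x - t) (1:R)
    by apply: (is_derive_eq (is_deriveB (is_derive_id y 1) (is_derive_cst t y 1))); rewrite subr0.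
  have H2 : is_derive y (1:R) (fun y => a^-1 * (A + (y - t)) `^ (- a)) _ :=
    is_derive1_comp (f := fun v => a^-1 * (A + v) `^ (- a)) (g := fun x => x - t) D2 E2.
  by apply: (is_derive_eq (is_deriveN H2)); rewrite mulr1 opprK.
- move=> y /andP[yt _]; have ty : 0 < y - t by rewrite subr_gt0.
  apply: (@continuous_comp _ _ _ (fun y : R => y - t) (fun v : R => (A + v) `^ (- (1 + a)))); last exact: cP.
  by apply: cvgB; [exact: cvg_id|exact: cvg_cst].
- by move=> y _; exact: powR_ge0.
- move=> y /andP[yt _]; have /Fb/andP[? ?] : 0 < y - t by rewrite subr_gt0.
  by apply/andP; split; lra.
Qed.

(** * The disc estimate *)

Local Open Scope complex_scope.

(** * Closure properties of measurable real functions *)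

Section measurability.
Context d (T : measurableType d) (R : realType).
Implicit Types f g : T -> R.

Lemma measurable_fun_powR f (a : R) : measurable_fun setT f ->
  measurable_fun setT (fun x => f x `^ a).
Proof. by move=> mf; exact: (measurableT_comp (measurable_powR a) mf). Qed.

Lemma measurable_fun_inv f : measurable_fun setT f ->
  measurable_fun setT (fun x => (f x)^-1).
Proof.
move=> mf.
(* The square makes the base of the real power nonnegative; at a zero of [f] both sides are 0, by
   the convention [0^-1 = 0]. *)
have -> : (fun x => (f x)^-1) = (fun x => f x * (f x ^+ 2) `^ (-1)).
  apply/funext => x; rewrite powR_inv1 ?sqr_ge0//.
  have [->|fx0] := eqVneq (f x) 0; first by rewrite mul0r invr0.
  by rewrite expr2 invfM mulrA mulfV// mul1r.
apply: measurable_funM => //; apply: measurable_fun_powR; exact: measurable_funX.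
Qed.

Lemma measurable_fun_sqrt f : measurable_fun setT f ->
  measurable_fun setT (fun x => Num.sqrt (f x)).
Proof.
move=> mf.
have -> : (fun x => Num.sqrt (f x)) = (fun x => (Order.max (f x) 0) `^ (2^-1)).
  apply/funext => x; have [fx0|fx0] := leP (f x) 0.
    by rewrite ler0_sqrtr// powR0 ?invr_neq0.
  by rewrite powR12_sqrt// ltW.
by apply: measurable_fun_powR; apply: measurable_maxr => //.
Qed.

Lemma measurable_fun_normr f : measurable_fun setT f ->
  measurable_fun setT (fun x => `|f x|).
Proof. by move=> mf; exact: measurableT_comp. Qed.

Lemma measurable_fun_ln f : measurable_fun setT f ->
  measurable_fun setT (fun x => ln (f x)).
Proof. by move=> mf; exact: (measurableT_comp (@measurable_ln R) mf). Qed.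

Lemma measurable_set_lt f g : measurable_fun setT f -> measurable_fun setT g ->
  measurable [set x | f x < g x].
Proof.
move=> mf mg; have := measurable_fun_ltr mf mg.
by move=> /(_ measurableT [set true]) => /(_ I); rewrite setTI.
Qed.

Lemma measurable_fun_patch (D : set T) f : measurable D -> measurable_fun setT f ->
  measurable_fun setT (fun x => (f \_ D) x).
Proof.
by move=> mD mf; apply/(measurable_restrictT f) => //; exact: (measurable_funS measurableT).
Qed.

End measurability.

Ltac meas :=
  repeat first
  [ assumption
  | exact: measurable_cst
  | exact: measurable_id
  | exact: measurable_fst
  | exact: measurable_snd
  | apply: measurable_funD
  | apply: measurable_funB
  | apply: measurable_funM
  | apply: measurable_fun_inv
  | apply: measurable_funX
  | apply: measurable_fun_normr
  | apply: measurable_fun_sqrt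
  | apply: measurable_fun_powR
  | apply: measurable_fun_ln
  | apply: measurable_funN
  | apply: (measurableT_comp measurable_fst)
  | apply: (measurableT_comp measurable_snd)].

Section disc.
Variable R : realType.

Lemma Im_le_normc (z : R[i]) : `|complex.Im z| <= normc z.
Proof.
case: z => x y /=; rewrite -sqrtr_sqr ler_sqrt ?lerDr ?sqr_ge0//.
by rewrite addr_ge0 ?sqr_ge0.
Qed.

Lemma Re_le_normc (z : R[i]) : `|complex.Re z| <= normc z.
Proof.
case: z => x y /=; rewrite -sqrtr_sqr ler_sqrt ?lerDl ?sqr_ge0//.
by rewrite addr_ge0 ?sqr_ge0.
Qed.

Lemma normc_ge0 (z : R[i]) : 0 <= normc z.
Proof. by case: z => x y; exact: sqrtr_ge0. Qed.

(* Where [|y| <= |x|], [sqrt (r^2 - y^2) >= 2 r / 3]. *)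
Lemma radial_ge_horizontal (r x y : R) : 0 < r -> x ^+ 2 + y ^+ 2 < r ^+ 2 ->
  `|y| <= `|x| ->
  0 < Num.sqrt (r ^+ 2 - y ^+ 2) - `|x| /\
  Num.sqrt (r ^+ 2 - y ^+ 2) - `|x| <= 3 * (r - Num.sqrt (x ^+ 2 + y ^+ 2)).
Proof.
move=> r0; rewrite -(real_normK (num_real x)) -(real_normK (num_real y)).
move: (`|x|) (`|y|) (normr_ge0 x) (normr_ge0 y) => X Y X0 Y0 XYr YX.
have b0 := sqrtr_ge0 (r ^+ 2 - Y ^+ 2); have n0 := sqrtr_ge0 (X ^+ 2 + Y ^+ 2).
have := sqr_sqrtr (a := r ^+ 2 - Y ^+ 2); have := sqr_sqrtr (a := X ^+ 2 + Y ^+ 2).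
move: (Num.sqrt _) (Num.sqrt _) b0 n0 => n b n0 b0.
move=> /(_ ltac:(nra)) n2 /(_ ltac:(nra)) b2.
have Xb : X < b by rewrite -(ltr_pXn2r (n := 2))// ?nnegrE//; lra.
have nr : n < r by rewrite -(ltr_pXn2r (n := 2))// ?nnegrE//; [rewrite n2|exact: ltW].
have YX2 : Y ^+ 2 <= X ^+ 2 by rewrite ler_pXn2r.
have b23 : 2 * r <= 3 * b.
  by rewrite -(ler_pXn2r (n := 2))// ?nnegrE; [nra|lra|lra].
split; first by lra.
(* Both products equal [r^2 - X^2 - Y^2]. The claim [b - X <= 3 (r - n)] thus reduces to
   [r + n <= 3 (b + X)], which holds because [n < r] and [2 r <= 3 b]. *)
have e : (r - n) * (r + n) = (b - X) * (b + X) by rewrite -!subr_sqr; lra.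
rewrite -(ler_pM2r (_ : 0 < r + n)); last by lra.
rewrite -mulrA e mulrCA; apply: ler_wpM2l; first by lra.
lra.
Qed.

(** Model integrand for the sector [|y| <= |x|]: the distance to the circle is taken along the
    horizontal chord, and the distance to the centre of the kernel keeps only its vertical part. At
    fixed [y] the integral in [x] is then of the form treated by [integral_interval_kernel]. *)
Let slice (r A a t x y : R) : R :=
  if x ^+ 2 + y ^+ 2 < r ^+ 2 then
    (Num.sqrt (r ^+ 2 - y ^+ 2) - `|x|) `^ (- a) *
    (A + `|y - t| + (Num.sqrt (r ^+ 2 - y ^+ 2) - `|x|)) ^- 2
  else 0.

Let slice_ge0 r A a t x y : 0 <= slice r A a t x y.
Proof.
by rewrite /slice; case: ifP => // _; rewrite mulr_ge0 ?powR_ge0// invr_ge0 sqr_ge0.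
Qed.

Let measurable_slice r A a t :
  measurable_fun setT (fun s : RL R * RL R => slice r A a t s.1 s.2).
Proof.
rewrite /slice; apply: measurable_fun_ifT.
- by apply: measurable_fun_ltr; meas.
- by meas.
- by meas.
Qed.

(** The inner integral is the interval estimate with [B = A + |y - t|] and half-length
    [sqrt (r^2 - y^2)]. It leaves [(A + |y - t|)^-(1+a)], which the line estimate integrates. *)
Let integral_slice r A a t : 0 < r -> 0 < A -> 0 < a -> a < 1 ->
  (\int[@lebesgue_measure R]_y \int[@lebesgue_measure R]_x (slice r A a t x y)%:E
   <= (4 * (1 - a)^-1 * a^-1 * A `^ (- a))%:E)%E.
Proof.
move=> r0 A0 a0 a1.
pose c := 2 * (1 - a)^-1.
have c0 : 0 <= c by rewrite mulr_ge0// invr_ge0 subr_ge0 ltW.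
apply: (@le_trans _ _ (\int[@lebesgue_measure R]_(y in `](- r)%R, r[)
    (c%:E * ((A + `|y - t|) `^ (- (1 + a)))%:E))%E).
  rewrite [leRHS]integral_mkcond; apply: le_lower_integral => y _.
    by apply: integral_ge0 => x _; rewrite lee_fin.
  rewrite patchE; case: ifPn => [|].
    rewrite inE/= in_itv/= => /andP[y1 y2].
    have y2r : y ^+ 2 < r ^+ 2 by nra.
    have := @integral_interval_kernel R a (A + `|y - t|) (Num.sqrt (r ^+ 2 - y ^+ 2)) a0 a1.
    move=> /(_ (ltr_wpDr (normr_ge0 _) A0) (sqrtr_ge0 _)).
    rewrite EFinM; apply: le_trans.
    rewrite [leRHS]integral_mkcond; apply: le_lower_integral => x _; first by rewrite lee_fin.
    rewrite patchE; case: ifPn => [_|].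
      by rewrite lee_fin /slice; case: ifP => // _; rewrite mulr_ge0 ?powR_ge0// invr_ge0 sqr_ge0.
    rewrite notin_setE/= in_itv/= -ltr_norml => /negP; rewrite -leNgt => xb.
    have xr : r ^+ 2 <= x ^+ 2 + y ^+ 2.
      have := sqr_sqrtr (a := r ^+ 2 - y ^+ 2); rewrite subr_ge0 (ltW y2r) => /(_ isT) e.
      have := sqrtr_ge0 (r ^+ 2 - y ^+ 2); have := real_normK (num_real x).
      nra.
    by rewrite lee_fin /slice ltNge xr.
  rewrite notin_setE/= in_itv/= -ltr_norml => /negP; rewrite -leNgt => yr.
  have xr x : r ^+ 2 <= x ^+ 2 + y ^+ 2.
    have := real_normK (num_real y); have := sqr_ge0 x; nra.
  by rewrite integral0_eq// => x _; rewrite /slice ltNge xr.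
rewrite ge0_integralZl_EFin; [|exact: measurable_itv
  |by move=> y _; rewrite lee_fin powR_ge0| |exact: c0]; last first.
  by apply/measurable_EFinP; apply/(measurable_funS _ (subsetT _)) => //; meas.
apply: (@le_trans _ _ (c%:E * (2 * a^-1 * A `^ (- a))%:E)%E).
  by apply: lee_wpmul2l; rewrite ?lee_fin//; exact: integral_line_kernel.
by rewrite -EFinM lee_fin le_eqVlt; apply/orP; left; apply/eqP; rewrite /c; ring.
Qed.

(** A Forelli-Rudin type estimate. [P] dominates the integrand on the sector [|y| <= |x|], and [Q],
    the same model with the coordinates exchanged, on the other. The constant is
    [216 = 27 (4 + 4)]. *)
Lemma integral_disc_kernel (r A a : R) (t : R[i]) :
  0 < r -> 0 < A -> 0 < a -> a < 1 ->
  (\int[@lebesgue_measure R \x @lebesgue_measure R]_(s in [set s | (normc (s.1 +i* s.2) < r)%R])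
     ((r - normc (s.1 +i* s.2)) `^ (- a) *
      (A + (r - normc (s.1 +i* s.2)) + normc (s.1 +i* s.2 - t)) ^- 2)%:E
   <= (216 * (1 - a)^-1 * a^-1 * A `^ (- a))%:E)%E.
Proof.
move=> r0 A0 a0 a1; case: t => t1 t2.
pose P (s : RL R * RL R) := slice r A a t2 s.1 s.2.
pose Q (s : RL R * RL R) := slice r A a t1 s.2 s.1.
have mP : measurable_fun setT P by exact: measurable_slice.
have mQ : measurable_fun setT Q.
  have mswap : measurable_fun setT (fun s : RL R * RL R => (s.2, s.1)).
    by apply: measurable_fun_pair; meas.
  exact: (measurableT_comp (measurable_slice r A a t1) mswap).
apply: (@le_trans _ _ (\int[@lebesgue_measure R \x @lebesgue_measure R]_s
   (27%:E * ((P s)%:E + (Q s)%:E)))%E).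
  rewrite integral_mkcond; apply: le_lower_integral => -[x y] _.
    apply: erestrict_ge0 => s _.
    by rewrite lee_fin mulr_ge0 ?powR_ge0// invr_ge0 sqr_ge0.
  rewrite patchE; case: ifPn => [|_]; last first.
    by rewrite -EFinD -EFinM lee_fin mulr_ge0// addr_ge0// slice_ge0.
  rewrite inE/= => xyr.
  have xyr2 : x ^+ 2 + y ^+ 2 < r ^+ 2.
    rewrite -(sqr_sqrtr (a := x ^+ 2 + y ^+ 2)) ?addr_ge0 ?sqr_ge0//.
    by rewrite ltr_pXn2r// ?nnegrE ?sqrtr_ge0 ?ltW.
  (* Replacing the radial distance [v] by the chord distance [u <= 3 v] costs [3^a <= 3] in the
     power and [3^2] in the squared denominator, hence 27. *)
  have key (u v w n : R) : 0 < u -> u <= 3 * v -> 0 <= w -> w <= n ->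
     v `^ (- a) * (A + v + n) ^- 2 <= 27 * (u `^ (- a) * (A + w + u) ^- 2).
    move=> u0 uv w0 wn; have v0 : 0 < v by lra.
    rewrite [leRHS](_ : _ = (3 * u `^ (- a)) * (9 * (A + w + u) ^- 2)); last by ring.
    apply: ler_pM; rewrite ?powR_ge0 ?invr_ge0 ?sqr_ge0//.
      apply: (@le_trans _ _ ((3^-1 * u) `^ (- a))).
        apply: ger0_lepowRN; [exact: ltW|by rewrite mulr_gt0|].
        by rewrite mulrC ler_pdivrMr// mulrC.
      have i3 : (0 : R) <= 3^-1 by rewrite invr_ge0.
      rewrite (powRM _ i3 (ltW u0)) ler_wpM2r ?powR_ge0//.
      have -> : (3^-1 : R) `^ (- a) = 3 `^ a.
        by rewrite -(powR_inv1 (a := 3))// -powRrM mulN1r opprK.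
      rewrite [leRHS](_ : _ = 3 `^ 1); last by rewrite powRr1.
      by apply: ler_powR; [rewrite ler1n|exact: ltW].
    rewrite -[9]invrK -invfM lef_pV2 ?posrE; last 2 first.
      by rewrite exprn_gt0//; lra.
      by rewrite mulr_gt0 ?invr_gt0 ?exprn_gt0//; lra.
    rewrite (_ : 9^-1 * _ = (3^-1 * (A + w + u)) ^+ 2); last by field.
    by rewrite ler_pXn2r ?nnegrE//; lra.
  rewrite -EFinD -EFinM lee_fin /P /Q /slice/= [y ^+ 2 + _]addrC xyr2 mulrDr.
  have [yx|xy] := leP `|y| `|x|.
    have [h1 h2] := radial_ge_horizontal _ _ _ r0 xyr2 yx.
    apply: (le_trans (key _ _ `|y - t2| _ h1 h2 _ _)) => //.
      exact: (Im_le_normc ((x - t1) +i* (y - t2))).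
    by rewrite lerDl mulr_ge0 ?mulr_ge0 ?powR_ge0// invr_ge0 sqr_ge0.
  have xyr2' : y ^+ 2 + x ^+ 2 < r ^+ 2 by rewrite addrC.
  have [h1] := radial_ge_horizontal _ _ _ r0 xyr2' (ltW xy).
  rewrite [y ^+ 2 + _]addrC => h2.
  apply: (le_trans (key _ _ `|x - t1| _ h1 h2 _ _)) => //.
    exact: (Re_le_normc ((x - t1) +i* (y - t2))).
  by rewrite lerDr mulr_ge0 ?mulr_ge0 ?powR_ge0// invr_ge0 sqr_ge0.
rewrite ge0_integralZl_EFin//; last 2 first.
- by move=> s _; rewrite adde_ge0// lee_fin slice_ge0.
- by apply: emeasurable_funD; apply/measurable_EFinP.
rewrite ge0_integralD//; last 4 first.
- by move=> s _; rewrite lee_fin slice_ge0.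
- by apply/measurable_EFinP.
- by move=> s _; rewrite lee_fin slice_ge0.
- by apply/measurable_EFinP.
rewrite fubini_tonelli2; last 2 first.
- by apply/measurable_EFinP.
- by move=> s; rewrite lee_fin slice_ge0.
rewrite [X in (_ + X)%E]fubini_tonelli1; last 2 first.
- by apply/measurable_EFinP.
- by move=> s; rewrite lee_fin slice_ge0.
apply: (@le_trans _ _ (27%:E * ((4 * (1 - a)^-1 * a^-1 * A `^ (- a))%:E +
  (4 * (1 - a)^-1 * a^-1 * A `^ (- a))%:E))%E).
  apply: lee_wpmul2l; first by rewrite lee_fin.
  by apply: leeD; exact: integral_slice.
by rewrite -EFinD -EFinM lee_fin le_eqVlt; apply/orP; left; apply/eqP; ring.
Qed.

End disc.

(** * Integrability of the weight at the origin *)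

Section radial_weight.
Variable R : realType.
Implicit Types (x y : R) (z : R[i]).

(** The profile of [hfun] as a function of the real variable [|z|], in which it can be
    differentiated. *)
Fixpoint hrad (k : nat) (x : R) : R :=
  match k with
  | 0 => 0
  | k'.+1 => match k' with
             | 0 => - ln x + 1
             | _ => ln (hrad k' x + 1) + 1
             end
  end.

Lemma hradS k x : hrad k.+2 x = ln (hrad k.+1 x + 1) + 1.
Proof. by []. Qed.

Lemma hfunE k z : hfun R k z = hrad k (normc z).
Proof. by elim: k => // -[|k] //= ->. Qed.

Lemma hrad_ge1 k x : 0 < x -> x < 1 -> 1 <= hrad k.+1 x.
Proof.
move=> x0 x1; elim: k => [|k IH].
  by rewrite /= lerDr oppr_ge0 ln_le0// ltW.
by rewrite hradS lerDr ln_ge0//; lra.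
Qed.

Lemma hrad_anti k x y : 0 < x -> x <= y -> y < 1 -> hrad k.+1 y <= hrad k.+1 x.
Proof.
move=> x0 xy y1; have y0 := lt_le_trans x0 xy; elim: k => [|k IH].
  by rewrite /= lerD2r lerN2 ler_ln ?posrE.
have h1 := hrad_ge1 k y y0 y1.
by rewrite !hradS lerD2r ler_ln ?posrE//; lra.
Qed.

Lemma measurable_hrad d (T : measurableType d) k (f : T -> R) :
  measurable_fun setT f -> measurable_fun setT (fun t => hrad k (f t)).
Proof.
move=> mf; elim: k => [|[|k] IH]; first exact: measurable_cst.
  by rewrite /=; apply: measurable_funD; meas; apply: measurable_funN; meas.
by apply: (eq_measurable_fun (fun t => ln (hrad k.+1 (f t) + 1) + 1)) => //; meas.
Qed.

Definition psi (alpha : R) (j : nat) x : R :=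
  hrad j x `^ alpha * \prod_(1 <= k < j) (hrad k x)^-1.

Lemma falphaE alpha j z :
  falpha R alpha j z = (normc z ^+ 2)^-1 * psi alpha j (normc z).
Proof.
rewrite /falpha /psi hfunE -mulrA; congr (_ * (_ * _)).
by apply: eq_bigr => k _; rewrite hfunE.
Qed.

Lemma psi_gt0 alpha j x : (0 < j)%N -> 0 < x -> x < 1 -> 0 < psi alpha j x.
Proof.
case: j => // j _ x0 x1; rewrite /psi mulr_gt0//.
  by rewrite powR_gt0// (lt_le_trans ltr01) ?hrad_ge1.
rewrite big_nat_cond; apply: prodr_gt0 => -[|k]; rewrite ?andbF// => _.
by rewrite invr_gt0 (lt_le_trans ltr01) ?hrad_ge1.
Qed.

(** Each factor of [psi] is a nonpositive power of a nonincreasing positive function [h_k]. *)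
Lemma psi_le alpha j x y : (0 < j)%N -> alpha <= 0 -> 0 < x -> x <= y -> y < 1 ->
  psi alpha j x <= psi alpha j y.
Proof.
case: j => // j _ a0 x0 xy y1; have y0 := lt_le_trans x0 xy.
have x1 := le_lt_trans xy y1.
have h0 k t : 0 < t -> t < 1 -> 0 < hrad k.+1 t.
  by move=> t0 t1; rewrite (lt_le_trans ltr01) ?hrad_ge1.
apply: ler_pM.
- exact: powR_ge0.
- rewrite big_nat_cond; apply: prodr_ge0 => -[|k]; rewrite ?andbF// => _.
  by rewrite invr_ge0 ltW ?h0.
- by rewrite -(opprK alpha); apply: ger0_lepowRN; rewrite ?oppr_ge0 ?h0 ?hrad_anti.
- rewrite [leLHS]big_nat_cond [leRHS]big_nat_cond.
  apply: ler_prod => -[|k]; rewrite ?andbF// => _.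
  by rewrite invr_ge0 ltW ?h0//= lef_pV2 ?posrE ?h0// hrad_anti.
Qed.

Lemma psi_le1 alpha j x : (0 < j)%N -> alpha <= 0 -> 0 < x -> x < 1 ->
  psi alpha j x <= 1.
Proof.
case: j => // j _ a0 x0 x1.
have h1 k : 1 <= hrad k.+1 x by exact: hrad_ge1.
rewrite /psi -[leRHS]mulr1; apply: ler_pM.
- exact: powR_ge0.
- rewrite big_nat_cond; apply: prodr_ge0 => -[|k]; rewrite ?andbF// => _.
  by rewrite invr_ge0 (le_trans ler01).
- have -> : (1 : R) = hrad j.+1 x `^ 0 by rewrite powRr0.
  exact: ler_powR.
- suff /andP[_] : 0 <= \prod_(1 <= k < j.+1) (hrad k x)^-1 <= 1 by [].
  rewrite big_nat_cond; apply: (big_ind (fun t : R => 0 <= t <= 1)).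
  + by rewrite ler01 lexx.
  + by move=> t u /andP[t0 t1] /andP[u0 u1]; rewrite mulr_ge0// mulr_ile1.
  + move=> [|k]; rewrite ?andbF// => _.
    have h := h1 k.
    by rewrite invr_ge0 (le_trans ler01 h)/= invf_le1 ?(lt_le_trans ltr01 h).
Qed.

Lemma measurable_psi d (T : measurableType d) alpha j (f : T -> R) :
  measurable_fun setT f -> measurable_fun setT (fun t => psi alpha j (f t)).
Proof.
move=> mf; apply: measurable_funM.
  by apply: measurable_fun_powR; exact: measurable_hrad.
elim: (index_iota 1 j) => [|k s IH].
  by under eq_fun do rewrite big_nil; exact: measurable_cst.
under eq_fun do rewrite big_cons.
apply: measurable_funM => //.
by apply: measurable_fun_inv; exact: measurable_hrad.
Qed.

(** For [j >= 1] this is minus the derivative of [h_j] on []0, 1[]: by the chain rule every outer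
    logarithm contributes a factor [1 / (h_k + 1)]. *)
Definition dhrad (j : nat) x : R := x^-1 * \prod_(1 <= k < j) (hrad k x + 1)^-1.

Lemma dhradS j x : dhrad j.+2 x = dhrad j.+1 x * (hrad j.+1 x + 1)^-1.
Proof. by rewrite /dhrad big_nat_recr//= mulrA. Qed.

Lemma dhrad_ge0 j x : 0 < x -> x < 1 -> 0 <= dhrad j.+1 x.
Proof.
move=> x0 x1; elim: j => [|j IH].
  by rewrite /dhrad big_geq// mulr1 invr_ge0 ltW.
rewrite dhradS mulr_ge0// invr_ge0; have := hrad_ge1 j x x0 x1; lra.
Qed.

Lemma is_derive_hrad j x : 0 < x -> x < 1 ->
  is_derive x (1:R) (hrad j.+1) (- dhrad j.+1 x).
Proof.
move=> x0 x1; elim: j => [|j IH].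
  apply: (is_derive_eq (is_deriveD (is_deriveN (is_derive1_ln x0)) (is_derive_cst (1:R) x 1))).
  by rewrite /dhrad big_geq// mulr1 addr0.
have h0 : 0 < hrad j.+1 x + 1 by have := hrad_ge1 j x x0 x1; lra.
have D1 := is_deriveD IH (is_derive_cst (1:R) x 1).
have D2 : is_derive x (1:R) (fun y => ln (hrad j.+1 y + 1)) _ :=
  is_derive1_comp (f := @ln R) (g := fun y => hrad j.+1 y + 1) (is_derive1_ln h0) D1.
apply: (is_derive_eq (is_deriveD D2 (is_derive_cst (1:R) x 1))).
by rewrite !addr0 dhradS mulrN mulrC.
Qed.

Lemma continuous_hrad j x : 0 < x -> x < 1 -> {for x, continuous (hrad j.+1)}.
Proof.
move=> x0 x1; have [H _] := is_derive_hrad j x x0 x1.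
by apply: differentiable_continuous; apply/derivable1_diffP.
Qed.

Lemma continuous_dhrad j x : 0 < x -> x < 1 -> {for x, continuous (dhrad j.+1)}.
Proof.
move=> x0 x1; elim: j => [|j IH].
  have -> : dhrad 1 = (fun x => x^-1).
    by apply/funext => y; rewrite /dhrad big_geq// mulr1.
  by apply: continuousV; [rewrite gt_eqF|exact: cvg_id].
have -> : dhrad j.+2 = (fun x => dhrad j.+1 x * (hrad j.+1 x + 1)^-1).
  by apply/funext => y; exact: dhradS.
apply: continuousM => //; apply: continuousV.
  by rewrite gt_eqF//; have := hrad_ge1 j x x0 x1; lra.
by apply: continuousD; [exact: continuous_hrad|exact: cvg_cst].
Qed.

(* [h_k + 1 <= 2 h_k] trades the factors of the weight for those of [h_j']. *)
Lemma psi_le_dhrad alpha j x : 0 < x -> x < 1 ->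
  x^-1 * psi alpha j.+1 x <= 2 ^+ j * (hrad j.+1 x `^ alpha * dhrad j.+1 x).
Proof.
move=> x0 x1; rewrite /psi [leLHS]mulrCA [leRHS]mulrCA ler_wpM2l ?powR_ge0//.
elim: j => [|j IH]; first by rewrite /dhrad !big_geq// mulr1 expr0 mul1r.
rewrite dhradS big_nat_recr// mulrA exprS.
rewrite (_ : 2 * 2 ^+ j * _ = (2 ^+ j * dhrad j.+1 x) * (2 * (hrad j.+1 x + 1)^-1)); last by ring.
have h1 := hrad_ge1 j x x0 x1.
apply: ler_pM => //.
- rewrite mulr_ge0 ?invr_ge0 ?(ltW x0)//.
  rewrite big_nat_cond; apply: prodr_ge0 => -[|k]; rewrite ?andbF// => _.
  by rewrite invr_ge0 (le_trans ler01)// hrad_ge1.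
- by rewrite invr_ge0; lra.
- rewrite -[2]invrK -invfM lef_pV2 ?posrE; lra.
Qed.

(** After [psi_le_dhrad] the integrand is at most the derivative of a multiple of [h_j^(alpha + 1)]
    evaluated at [2 x]. As [h_j >= 1] and [alpha + 1 < 0], this primitive stays between 0 and its
    constant factor: here [alpha < -1] gives integrability at 0. The argument [2 x] anticipates
    [|z| <= 2 |x|] on a sector, and [x < 1/4] keeps it inside the unit interval. *)
Lemma integral_psi (alpha : R) (j : nat) : alpha < -1 ->
  (\int[@lebesgue_measure R]_(x in `]0%R, (4^-1)%R[)
     (x^-1 * psi alpha j.+1 (2 * x))%:E <= (2 ^+ j * (- (alpha + 1))^-1)%:E)%E.
Proof.
move=> al; have al0 : 0 < - (alpha + 1) by lra.
pose c : R := 2 ^+ j * (- (alpha + 1))^-1.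
have c0 : 0 <= c by rewrite mulr_ge0 ?exprn_ge0 ?invr_ge0 ?ltW.
pose g (u : R) := 2 ^+ j * (hrad j.+1 u `^ alpha * dhrad j.+1 u).
pose G (u : R) := c * hrad j.+1 u `^ (alpha + 1).
have b2 (x : R) : 0 < x < 4^-1 -> 0 < 2 * x /\ 2 * x < 1.
  by move=> /andP[x0 x4]; split; lra.
have dG (u : R) : 0 < u -> u < 1 -> is_derive u (1:R) G (g u).
  move=> u0 u1.
  have h0 : 0 < hrad j.+1 u by rewrite (lt_le_trans ltr01) ?hrad_ge1.
  have D := is_derive_powR_comp _ _ _ (alpha + 1) _ h0 (is_derive_hrad j u u0 u1).
  apply: (is_derive_eq (is_deriveZ c D)).
  rewrite /g /c /GRing.scale/= addrK; field.
  by rewrite -oppr_eq0 gt_eqF//; lra.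
apply: (@le_trans _ _ (\int[@lebesgue_measure R]_(x in `]0%R, (4^-1)%R[) (2 * g (2 * x))%:E)%E).
  apply: le_lower_integral => x; rewrite /= in_itv/= => /[dup] /b2[u0 u1] /andP[x0 _].
    by rewrite lee_fin mulr_ge0 ?invr_ge0 ?ltW// psi_gt0.
  rewrite lee_fin (_ : x^-1 = 2 * (2 * x)^-1); last by field; rewrite gt_eqF.
  by rewrite -mulrA ler_wpM2l// psi_le_dhrad.
rewrite -/c -[leRHS](_ : (c - 0)%:E = _)%E; last by rewrite subr0.
apply: (@integral_le_primitive R 0 4^-1 0 c (fun x => G (2 * x))) => //.
- move=> x /b2[u0 u1].
  have E : is_derive x (1:R) (fun x => 2 * x) (2:R).
    by apply: (is_derive_eq (is_deriveZ 2 (is_derive_id x 1))); rewrite /GRing.scale/= mulr1.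
  have H : is_derive x (1:R) (fun x => G (2 * x)) _ :=
    is_derive1_comp (f := G) (g := fun x => 2 * x) (dG _ u0 u1) E.
  by apply: (is_derive_eq H); rewrite mulrC.
- move=> x /b2[u0 u1]; apply: continuousM; first exact: cvg_cst.
  apply: (@continuous_comp _ _ _ (fun y : R => 2 * y) g).
    by apply: cvgM; [exact: cvg_cst|exact: cvg_id].
  apply: continuousM; first exact: cvg_cst.
  apply: continuousM; last exact: continuous_dhrad.
  apply: (@continuous_comp _ _ _ (hrad j.+1) (fun y : R => y `^ alpha)).
    exact: continuous_hrad.
  by apply: continuous_powR; rewrite (lt_le_trans ltr01) ?hrad_ge1.
- move=> x /b2[u0 u1]; rewrite mulr_ge0// mulr_ge0 ?exprn_ge0// mulr_ge0 ?powR_ge0//.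
  exact: dhrad_ge0.
- move=> x /b2[u0 u1]; rewrite /G mulr_ge0 ?powR_ge0//=.
  rewrite -[leRHS]mulr1 ler_wpM2l// -[leRHS](powRr0 (hrad j.+1 (2 * x))).
  by apply: ler_powR; [exact: hrad_ge1|lra].
Qed.

(* On [|y| <= |x|] the norm lies between [|x|] and [2 |x|]. *)
Let slice (alpha : R) (j : nat) x y : R :=
  if (`|x| < 4^-1) && (`|y| <= `|x|) then (`|x| ^+ 2)^-1 * psi alpha j (2 * `|x|) else 0.

Let slice_ge0 alpha j x y : 0 <= slice alpha j.+1 x y.
Proof.
rewrite /slice; case: ifP => // /andP[x4 _].
have [->|x0] := eqVneq x 0; first by rewrite normr0 expr0n/= invr0 mul0r.
rewrite mulr_ge0 ?invr_ge0 ?sqr_ge0// ltW// psi_gt0 ?mulr_gt0 ?normr_gt0//; lra.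
Qed.

Let measurable_slice alpha j :
  measurable_fun setT (fun s : RL R * RL R => slice alpha j s.1 s.2).
Proof.
rewrite /slice; apply: measurable_fun_ifT.
- by apply: measurable_and; [apply: measurable_fun_ltr|apply: measurable_fun_ler]; meas.
- by apply: measurable_funM; [|apply: measurable_psi]; meas.
- by meas.
Qed.

(** At fixed [x] the integrand is constant on [|y| <= |x|], an interval of length [2 |x|], which
    turns [|x|^-2] into [2 |x|^-1]. The two halves of the [x]-axis then contribute equally. *)
Let integral_slice alpha j : alpha < -1 ->
  (\int[@lebesgue_measure R]_x \int[@lebesgue_measure R]_y (slice alpha j.+1 x y)%:E
   <= (4 * (2 ^+ j * (- (alpha + 1))^-1))%:E)%E.
Proof.
move=> al.
pose f (x : R) := `|x|^-1 * psi alpha j.+1 (2 * `|x|).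
pose B := 2 ^+ j * (- (alpha + 1))^-1.
have f0 (x : R) : - 4^-1 < x < 4^-1 -> 0 <= f x.
  rewrite -ltr_norml => x4.
  rewrite /f; have [->|x0] := eqVneq x 0; first by rewrite normr0 invr0 mul0r.
  rewrite mulr_ge0 ?invr_ge0// ltW// psi_gt0 ?mulr_gt0 ?normr_gt0//; lra.
have mf D : measurable_fun D (fun y => (f y)%:E).
  apply/measurable_EFinP; apply/(measurable_funS _ (subsetT _)) => //.
  by apply: measurable_funM; [|apply: measurable_psi]; meas.
apply: (@le_trans _ _ (\int[@lebesgue_measure R]_(x in `](- 4^-1)%R, (4^-1)%R[)
    (2%:E * (f x)%:E))%E).
  rewrite [leRHS]integral_mkcond; apply: le_lower_integral => x _.
    by apply: integral_ge0 => y _; rewrite lee_fin.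
  rewrite patchE; case: ifPn => [|].
    rewrite inE/= in_itv/= -ltr_norml => x4.
    pose k := (`|x| ^+ 2)^-1 * psi alpha j.+1 (2 * `|x|).
    apply: (@le_trans _ _ (\int[@lebesgue_measure R]_(y in `[(- `|x|)%R, (`|x|)%R]) k%:E)%E).
      rewrite [leRHS]integral_mkcond; apply: le_lower_integral => y _; first by rewrite lee_fin.
      rewrite patchE; case: ifPn => [|].
        by rewrite inE/= in_itv/= -ler_norml /slice x4 => ->.
      by rewrite notin_setE/= in_itv/= -ler_norml /slice x4 => /negP/negbTE ->.
    rewrite integral_cst//= lebesgue_measure_itv/= lte_fin.
    have [->|x0] := eqVneq x 0.
      by rewrite normr0 oppr0 ltxx mule0 -EFinM /f normr0 invr0 mul0r mulr0.
    have nx : 0 < `|x| by rewrite normr_gt0.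
    rewrite gtrN// -EFinB -!EFinM lee_fin le_eqVlt; apply/orP; left; apply/eqP.
    by rewrite /k /f; field; rewrite gt_eqF.
  rewrite notin_setE/= in_itv/= -ltr_norml => /negP/negbTE x4.
  by rewrite integral0_eq// => y _; rewrite /slice x4.
rewrite ge0_integralZl_EFin; [|exact: measurable_itv
  |by move=> y; rewrite /= in_itv/= lee_fin; exact: f0|exact: mf|by []].
rewrite (_ : 4 * _ = 2 * (2 * B)); last by rewrite /B; ring.
rewrite EFinM; apply: lee_wpmul2l; first by rewrite lee_fin.
have sub : `]- 4^-1, 4^-1[%classic = `]- 4^-1, 0] `|` `]0, 4^-1[ :> set R.
  apply/seteqP; split => x; rewrite /= !in_itv/=.
    by move=> /andP[-> ->]; rewrite andbT/=; case: (leP x 0) => _; [left|right].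
  by move=> [] /andP[h1 h2]; apply/andP; split; lra.
have dis : [disjoint `]- 4^-1, (0:R)] & `](0:R), 4^-1[].
  rewrite disj_set2E; apply/eqP/seteqP; split => // y [] /=.
  by rewrite !in_itv/= => /andP[_ yt] /andP[ty _]; have := lt_le_trans ty yt; rewrite ltxx.
rewrite sub ge0_integral_setU; [|exact: measurable_itv|exact: measurable_itv|exact: mf
  | |exact: dis]; last first.
  by move=> x; rewrite -sub /= in_itv/= lee_fin; exact: f0.
rewrite -integral_itv_bndo_bndc; last exact: mf.
rewrite (_ : 2 * B = B + B); last by ring.
rewrite EFinD; apply: leeD.
  (* The left half is carried onto []0, 1/4[] by [x -> - x], under which Lebesgue measure is
     invariant. *)
  have -> : `]- 4^-1, (0:R)[%classic = (-%R : _ -> measurableTypeR R) @^-1` `]0, 4^-1[.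
    by rewrite opp_preimage_itvbndbnd oppr0.
  apply: (@le_trans _ _ (\int[pushforward (@lebesgue_measure R) (-%R : _ -> measurableTypeR R)]_(x in
      `]0%R, (4^-1)%R[) (f x)%:E)%E).
    rewrite ge0_integral_pushforward; last 3 first.
    - exact: measurable_itv.
    - exact: mf.
    - by move=> x; rewrite inE /= in_itv/= lee_fin => h; apply: f0; lra.
    apply: le_lower_integral => x; rewrite /= in_itv/= => h.
      by rewrite lee_fin; apply: f0; lra.
    by rewrite /f normrN.
    by apply: oppr_measurable.
  apply: (le_trans _ (integral_psi alpha j al)).
  rewrite (eq_measure_integral (@lebesgue_measure R)); last first.
    by move=> A mA AS; exact: lebesgue_measureN.
  apply: le_lower_integral => x; rewrite /= in_itv/= lee_fin => h.
    by apply: f0; lra.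
  by rewrite /f gtr0_norm; lra.
apply: (le_trans _ (integral_psi alpha j al)).
apply: le_lower_integral => x; rewrite /= in_itv/= => h.
  by rewrite lee_fin; apply: f0; lra.
by rewrite lee_fin /f gtr0_norm; lra.
Qed.

(** The two sectors are dominated by [slice] and by [slice] with exchanged coordinates, each of
    integral at most [4 * 2^j / - (alpha + 1)]. *)
Lemma integral_falpha_le (alpha : R) (j : nat) : alpha < -1 ->
  (\int[@lebesgue_measure R \x @lebesgue_measure R]_(s in
       [set s | (normc (s.1 +i* s.2) < 4^-1)%R]) (falpha R alpha j.+1 (s.1 +i* s.2))%:E
   <= (8 * (2 ^+ j * (- (alpha + 1))^-1))%:E)%E.
Proof.
move=> al.
pose P (s : RL R * RL R) := slice alpha j.+1 s.1 s.2.
pose Q (s : RL R * RL R) := slice alpha j.+1 s.2 s.1.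
have mP : measurable_fun setT P by exact: measurable_slice.
have mQ : measurable_fun setT Q.
  have mswap : measurable_fun setT (fun s : RL R * RL R => (s.2, s.1)).
    by apply: measurable_fun_pair; meas.
  exact: (measurableT_comp (measurable_slice alpha j.+1) mswap).
apply: (@le_trans _ _ (\int[@lebesgue_measure R \x @lebesgue_measure R]_s
   ((P s)%:E + (Q s)%:E))%E).
  rewrite integral_mkcond; apply: le_lower_integral => -[x y] _.
    apply: erestrict_ge0 => s s4; rewrite lee_fin falphaE.
    have {s4} : normc (s.1 +i* s.2) < 4^-1 := s4.
    move: (normc _) (normc_ge0 _ (s.1 +i* s.2)) => n n0 n4.
    have [->|s0] := eqVneq n 0; first by rewrite expr0n/= invr0 mul0r.
    have {}n0 : 0 < n by rewrite lt_neqAle eq_sym s0.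
    by rewrite mulr_ge0 ?invr_ge0 ?sqr_ge0// ltW// psi_gt0//; lra.
  rewrite patchE; case: ifPn => [|_]; last first.
    by rewrite -EFinD lee_fin addr_ge0// slice_ge0.
  rewrite inE /= => xy4; rewrite -EFinD lee_fin falphaE /=.
  (* Here [u] is the larger coordinate in absolute value and [n] the norm. From [u <= n <= 2 u], the
     factor [n^-2] is controlled by the lower bound and the nondecreasing [psi] by the upper one. *)
  have key (u v n : R) : 0 <= v -> v <= u -> u <= n -> n <= u + v -> n < 4^-1 ->
    (n ^+ 2)^-1 * psi alpha j.+1 n <= (u ^+ 2)^-1 * psi alpha j.+1 (2 * u).
    move=> v0 vu un nuv n4.
    have [u0|u0] := eqVneq u 0.
      have -> : n = 0 by lra.
      by rewrite u0 expr0n/= invr0 !mul0r.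
    have {}u0 : 0 < u by rewrite lt_neqAle eq_sym u0; lra.
    apply: ler_pM; rewrite ?invr_ge0 ?sqr_ge0//.
    - by rewrite ltW// psi_gt0//; lra.
    - have n0 : 0 < n by lra.
      by rewrite lef_pV2 ?posrE ?exprn_gt0// ler_pXn2r// nnegrE; exact: ltW.
    - by apply: psi_le => //; lra.
  set n := Num.sqrt _ in xy4 *.
  have xn : `|x| <= n := Re_le_normc _ (x +i* y).
  have yn : `|y| <= n := Im_le_normc _ (x +i* y).
  have nxy : n <= `|x| + `|y|.
    rewrite -(ler_pXn2r (n := 2))// ?nnegrE ?sqrtr_ge0 ?addr_ge0//.
    rewrite sqr_sqrtr ?addr_ge0 ?sqr_ge0// sqrrD !real_normK ?num_real//.
    by rewrite lerD2r lerDl mulrn_wge0// mulr_ge0.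
  have [yx|xy] := leP `|y| `|x|.
    apply: (@le_trans _ _ (P (x, y))); last by rewrite lerDl slice_ge0.
    rewrite /P /slice /= yx (le_lt_trans xn xy4) /=.
    exact: (key _ `|y|).
  apply: (@le_trans _ _ (Q (x, y))); last by rewrite lerDr slice_ge0.
  rewrite /Q /slice /= (ltW xy) (le_lt_trans yn xy4) /=.
  by apply: (key _ `|x|) => //; [exact: ltW|rewrite addrC].
rewrite ge0_integralD//; last 4 first.
- by move=> s _; rewrite lee_fin slice_ge0.
- by apply/measurable_EFinP.
- by move=> s _; rewrite lee_fin slice_ge0.
- by apply/measurable_EFinP.
rewrite fubini_tonelli1; last 2 first.
- by apply/measurable_EFinP.
- by move=> s; rewrite lee_fin slice_ge0.
rewrite [X in (_ + X)%E]fubini_tonelli2; last 2 first.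
- by apply/measurable_EFinP.
- by move=> s; rewrite lee_fin slice_ge0.
rewrite (_ : 8 * _ = 4 * (2 ^+ j * (- (alpha + 1))^-1) + 4 * (2 ^+ j * (- (alpha + 1))^-1)); last by ring.
by rewrite EFinD; apply: leeD; exact: integral_slice.
Qed.
End radial_weight.

(** * The Bergman kernel *)

Set Implicit Arguments.
Unset Strict Implicit.

(** * Measurability of complex-valued functions, by coordinates *)

Section complex_measurability.
Context d (T : measurableType d) (R : realType).
Implicit Types F G : T -> R[i].

Definition cmeasurable F : Prop :=
  measurable_fun setT (fun x => complex.Re (F x)) /\
  measurable_fun setT (fun x => complex.Im (F x)).

Lemma cmeasurable_cst (c : R[i]) : cmeasurable (fun=> c).
Proof. by split; exact: measurable_cst. Qed.

Lemma cmeasurable_pair (f g : T -> R) :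
  measurable_fun setT f -> measurable_fun setT g -> cmeasurable (fun x => f x +i* g x).
Proof. by []. Qed.

Lemma cmeasurableB F G : cmeasurable F -> cmeasurable G ->
  cmeasurable (fun x => F x - G x).
Proof.
move=> [F1 F2] [G1 G2]; split.
  apply: (eq_measurable_fun (fun x => complex.Re (F x) - complex.Re (G x))).
    by move=> x _; case: (F x) (G x) => ? ? [].
  exact: measurable_funB.
apply: (eq_measurable_fun (fun x => complex.Im (F x) - complex.Im (G x))).
  by move=> x _; case: (F x) (G x) => ? ? [].
exact: measurable_funB.
Qed.

Lemma cmeasurableM F G : cmeasurable F -> cmeasurable G ->
  cmeasurable (fun x => F x * G x).
Proof.
move=> [F1 F2] [G1 G2]; split.
  apply: (eq_measurable_fun (fun x => complex.Re (F x) * complex.Re (G x)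
     - complex.Im (F x) * complex.Im (G x))).
    by move=> x _; case: (F x) (G x) => ? ? [].
  by apply: measurable_funB; exact: measurable_funM.
apply: (eq_measurable_fun (fun x => complex.Re (F x) * complex.Im (G x)
     + complex.Im (F x) * complex.Re (G x))).
  by move=> x _; case: (F x) (G x) => ? ? [].
by apply: measurable_funD; exact: measurable_funM.
Qed.

Lemma cmeasurable_sqr F : cmeasurable F -> cmeasurable (fun x => F x ^+ 2).
Proof. by move=> mF; under eq_fun do rewrite expr2; exact: cmeasurableM. Qed.

Lemma cmeasurable_conj F : cmeasurable F -> cmeasurable (fun x => (F x)^*).
Proof.
move=> [F1 F2]; split.
  apply: (eq_measurable_fun (fun x => complex.Re (F x))) => //.
  by move=> x _; case: (F x).
apply: (eq_measurable_fun (fun x => - complex.Im (F x))).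
  by move=> x _; case: (F x).
exact: measurable_funN.
Qed.

Lemma cmeasurableV F : cmeasurable F -> cmeasurable (fun x => (F x)^-1).
Proof.
move=> [F1 F2].
have m2 : measurable_fun setT
    (fun x => (complex.Re (F x) ^+ 2 + complex.Im (F x) ^+ 2)^-1).
  by apply: measurable_fun_inv; apply: measurable_funD; exact: measurable_funX.
split.
  apply: (eq_measurable_fun (fun x => complex.Re (F x) *
      (complex.Re (F x) ^+ 2 + complex.Im (F x) ^+ 2)^-1)).
    by move=> x _; case: (F x).
  exact: measurable_funM.
apply: (eq_measurable_fun (fun x => - (complex.Im (F x) *
      (complex.Re (F x) ^+ 2 + complex.Im (F x) ^+ 2)^-1))).
  by move=> x _; case: (F x).
by apply: measurable_funN; exact: measurable_funM.
Qed.

Lemma measurable_normc F : cmeasurable F -> measurable_fun setT (fun x => normc (F x)).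
Proof.
move=> [F1 F2].
apply: (eq_measurable_fun
    (fun x => Num.sqrt (complex.Re (F x) ^+ 2 + complex.Im (F x) ^+ 2))).
  by move=> x _; case: (F x).
by apply: measurable_fun_sqrt; apply: measurable_funD; exact: measurable_funX.
Qed.

End complex_measurability.

Lemma cmeasurable_comp d d' (T : measurableType d) (T' : measurableType d')
    (R : realType) (F : T -> R[i]) (g : T' -> T) :
  cmeasurable F -> measurable_fun setT g -> cmeasurable (fun x => F (g x)).
Proof.
by move=> [F1 F2] mg; split; [exact: (measurableT_comp F1)|exact: (measurableT_comp F2)].
Qed.

Section kernel.
Variable R : realType.
Notation m2 := (@lebesgue_measure R \x @lebesgue_measure R)%E.
Implicit Types z w : C2 R.

Lemma cmeasurable_z1 : cmeasurable (z1 R).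
Proof. by apply: cmeasurable_pair; meas. Qed.

Lemma cmeasurable_z2 : cmeasurable (z2 R).
Proof. by apply: cmeasurable_pair; meas. Qed.

Lemma cmeasurable_kernel :
  cmeasurable (fun p : C2 R * C2 R => bergman_kernel R p.1 p.2).
Proof.
have f1 : cmeasurable (fun p : C2 R * C2 R => z1 R p.1) :=
  cmeasurable_comp cmeasurable_z1 measurable_fst.
have f2 : cmeasurable (fun p : C2 R * C2 R => z2 R p.1) :=
  cmeasurable_comp cmeasurable_z2 measurable_fst.
have g1 : cmeasurable (fun p : C2 R * C2 R => (z1 R p.2)^*) :=
  cmeasurable_conj (cmeasurable_comp cmeasurable_z1 measurable_snd).
have g2 : cmeasurable (fun p : C2 R * C2 R => (z2 R p.2)^*) :=
  cmeasurable_conj (cmeasurable_comp cmeasurable_z2 measurable_snd).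
have c1 : cmeasurable (fun p : C2 R * C2 R => 1 : R[i]) := cmeasurable_cst _ _.
have q := cmeasurableV (cmeasurableM f2 g2).
apply: cmeasurableV; apply: cmeasurableM; last first.
  exact: cmeasurable_sqr (cmeasurableB c1 (cmeasurableM f2 g2)).
apply: cmeasurableM; last first.
  exact: cmeasurable_sqr (cmeasurableB c1 (cmeasurableM (cmeasurableM f1 g1) q)).
apply: cmeasurableM => //; apply: cmeasurableM => //; exact: cmeasurable_cst.
Qed.

Let lam : {sigma_finite_measure set (RL R) -> \bar R} := @lebesgue_measure R.
Let M2 : {sigma_finite_measure set (RL R * RL R)%type -> \bar R} := prodm lam lam.
Let M3 : {sigma_finite_measure set (RL R * RL R * RL R)%type -> \bar R} := prodm M2 lam.
(** The measure [vol4] again, now carrying the sigma-finite structure that Tonelli's theorem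
    requires. *)
Definition vol : {sigma_finite_measure set (C2 R) -> \bar R} := prodm M3 lam.

(** The variable [w1] is innermost because the fibre of the Hartogs triangle over [w2] is a disc.
    The coordinates of [w2] are peeled off one at a time by Tonelli, and then regrouped into a
    planar integral. *)
Lemma integral_vol4 (f : C2 R -> \bar R) :
  measurable_fun setT f -> (forall w, 0 <= f w)%E ->
  (\int[vol4 R]_w f w = \int[m2]_s \int[m2]_t f (((t.1, t.2), s.1), s.2))%E.
Proof.
move=> mf f0.
have E := @fubini_tonelli2 _ _ _ _ R M3 lam f mf f0.
transitivity (\int[lam]_y (fubini_G M3 f y))%E.
  exact: E.
have mg : measurable_fun setT (fun p : (RL R * RL R) * (RL R * RL R) =>
    f ((p.1, p.2.1), p.2.2)).
  apply: (measurableT_comp mf); apply: measurable_fun_pair; last by meas.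
  by apply: measurable_fun_pair; meas.
have -> : (fun s : RL R * RL R => \int[m2]_t f (((t.1, t.2), s.1), s.2))%E =
          (fun s => \int[m2]_t f ((t, s.1), s.2))%E.
  by apply/funext => s; apply: eq_integral => -[].
have mG := @measurable_fun_fubini_tonelli_G _ _ _ _ R M2 _ mg (fun=> f0 _).
have E2 := @fubini_tonelli2 _ _ _ _ R lam lam _ mG (fun s => integral_ge0 _ (fun t _ => f0 _)).
transitivity (\int[lam]_y fubini_G lam (fubini_G M2 (fun p : (RL R * RL R) * (RL R * RL R) => f ((p.1, p.2.1), p.2.2))) y)%E; last first.
  exact: (esym E2).
apply: eq_integral => y _; rewrite /fubini_G.
have my : measurable_fun setT (fun u => f (u, y)).
  by apply: (measurableT_comp mf); apply: measurable_fun_pair; meas.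
exact: (@fubini_tonelli2 _ _ _ _ R M2 lam (fun u => f (u, y)) my (fun=> f0 _)).
Qed.

Lemma normcB_ge (z w : R[i]) : normc z - normc w <= normc (z - w).
Proof. by rewrite lerBlDr (le_trans _ (le_normcD _ _))// subrK. Qed.

Lemma normc_conj (z : R[i]) : normc z^* = normc z.
Proof. by case: z => x y /=; rewrite sqrrN. Qed.

Lemma mulc_conj (z : R[i]) : z * z^* = (normc z ^+ 2)%:C.
Proof.
case: z => x y; rewrite [normc _]/= sqr_sqrtr ?addr_ge0 ?sqr_ge0//.
by apply/eqP; rewrite eq_complex /=; apply/andP; split; apply/eqP; ring.
Qed.

Lemma normc_real (x : R) : normc x%:C = `|x|.
Proof. by rewrite /= expr0n/= addr0 sqrtr_sqr. Qed.

Lemma distance_le_kernel (t s : R[i]) : normc t < 1 -> normc s < 1 ->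
  (1 - normc t) + (1 - normc s) + normc (s - t) <= 5 * normc (1 - t * s^*).
Proof.
move=> t1 s1; have t0 := normc_ge0 _ t; have s0 := normc_ge0 _ s.
have n1 : normc (1 : R[i]) = 1 by exact: normc1.
have h1 : 1 - normc t * normc s <= normc (1 - t * s^*).
  by have := normcB_ge 1 (t * s^*); rewrite n1 normcM normc_conj.
have e : s - t = s * (1 - t * s^*) - t * (1 - s * s^*) by ring.
have h2 : normc (s - t) <= normc s * normc (1 - t * s^*) + normc t * (1 - normc s ^+ 2).
  rewrite e (le_trans (le_normcD _ _))// normcN !normcM lerD2l ler_wpM2l//.
  rewrite mulc_conj (_ : 1 - (normc s ^+ 2)%:C = (1 - normc s ^+ 2)%:C); last first.
    by rewrite rmorphB rmorph1.
  by rewrite normc_real ger0_norm// subr_ge0 expr_le1// ltW.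
have h0 := normc_ge0 _ (1 - t * s^*).
nra.
Qed.

Lemma normc_kernel z w : normc (bergman_kernel R z w) =
  (pi ^+ 2 * normc (z2 R z) * normc (z2 R w)
   * normc (1 - z1 R z * (z1 R w)^* / (z2 R z * (z2 R w)^*)) ^+ 2
   * normc (1 - z2 R z * (z2 R w)^*) ^+ 2)^-1.
Proof.
rewrite /bergman_kernel normcV !expr2 !normcM !normc_conj normc_real ger0_norm//.
by rewrite mulr_ge0// pi_ge0.
Qed.

(** Each [1 - a b^*] turns into its conjugate when [a] and [b] are exchanged. Hence one Schur bound
    serves for integration in either variable. *)
Lemma normc_kernelC z w :
  normc (bergman_kernel R z w) = normc (bergman_kernel R w z).
Proof.
rewrite !normc_kernel.
have e (a b : R[i]) : normc (1 - a * b^*) = normc (1 - b * a^*).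
  rewrite -normc_conj rmorphB rmorph1 rmorphM /=.
  by case: a b => a1 a2 [b1 b2] /=; congr Num.sqrt; ring.
have -> : normc (1 - z1 R z * (z1 R w)^* / (z2 R z * (z2 R w)^*)) =
          normc (1 - z1 R w * (z1 R z)^* / (z2 R w * (z2 R z)^*)).
  have r (a b c d : R[i]) : a * b^* / (c * d^*) = (a / c) * (b / d)^*.
    by rewrite rmorphM fmorphV invfM mulrACA.
  by rewrite !r e.
by rewrite e [_ * normc (z2 R w)]mulrAC.
Qed.

Definition gweight (b : R) w : R :=
  (normc (z2 R w))^-1 * (1 - normc (z1 R w) / normc (z2 R w)) `^ (- b)
  * (1 - normc (z2 R w)) `^ (- b).

(* The distance to the boundary is measured in the disc [|w1| < |w2|], whose
   radius varies; no rescaling of the variable [w1] is needed. *)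
Lemma kernel_le z w : Hartogs R z -> Hartogs R w ->
  normc (bergman_kernel R z w) <= 625 * (normc (z2 R z))^-1 * normc (z2 R w) *
    (normc (z2 R w) * (1 - normc (z1 R z / z2 R z)) + (normc (z2 R w) - normc (z1 R w))
      + normc (z1 R w - z1 R z / z2 R z * z2 R w)) ^- 2 *
    ((1 - normc (z2 R z)) + (1 - normc (z2 R w)) + normc (z2 R w - z2 R z)) ^- 2.
Proof.
move=> /andP[z12 z21] /andP[w12 w21]; rewrite normc_kernel.
move: (z1 R z) (z2 R z) (z1 R w) (z2 R w) z12 z21 w12 w21 => a c b d ac c1 bd d1.
have c0 : 0 < normc c by rewrite (le_lt_trans _ ac) ?normc_ge0.
have d0 : 0 < normc d by rewrite (le_lt_trans _ bd) ?normc_ge0.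
have cn0 : c != 0 by apply: contraTneq c0 => ->; rewrite normc0 ltxx.
have dn0 : d != 0 by apply: contraTneq d0 => ->; rewrite normc0 ltxx.
pose t := a / c; pose s := b / d.
have tE : normc t = normc a / normc c by rewrite normcM normcV.
have sE : normc s = normc b / normc d by rewrite normcM normcV.
have t1 : normc t < 1 by rewrite tE ltr_pdivrMr// mul1r.
have s1 : normc s < 1 by rewrite sE ltr_pdivrMr// mul1r.
have -> : a * b^* / (c * d^*) = t * s^* by rewrite /t /s rmorphM fmorphV invfM mulrACA.
(* The comparison is used for the quotients [t], [s] and for the second coordinates. Both enter
   squared, whence [625 = 5^4]. *)
have h1 := distance_le_kernel t1 s1.
have h2 := distance_le_kernel c1 d1.
(* Multiplying by [|w2|] replaces the quotient [s = w1 / w2] by [w1] itself. *)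
have dE : normc d * (1 - normc t) + (normc d - normc b) + normc (b - t * d) =
          normc d * ((1 - normc t) + (1 - normc s) + normc (s - t)).
  have e1 : normc d * (1 - normc s) = normc d - normc b.
    by rewrite sE; field; rewrite gt_eqF.
  have e2 : normc d * normc (s - t) = normc (b - t * d).
    by rewrite -normcM mulrBr /s mulrCA mulfV// mulr1 [d * t]mulrC.
  by rewrite [RHS]mulrDr [X in _ = X + _]mulrDr e1 e2.
rewrite -/t dE.
have x0 : 0 < (1 - normc t) + (1 - normc s) + normc (s - t).
  by have := normc_ge0 _ (s - t); lra.
have y0 : 0 < (1 - normc c) + (1 - normc d) + normc (d - c).
  by have := normc_ge0 _ (d - c); lra.
move: (_ + normc (s - t)) (_ + normc (d - c)) (normc (1 - _)) (normc (1 - _)) x0 y0 h1 h2.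
move=> X Y n1 n2 X0 Y0 X1 Y1.
have n10 : 0 < n1 by lra.
have n20 : 0 < n2 by lra.
move: (normc c) (normc d) c0 d0 => C D C0 D0.
rewrite (_ : 625 * C^-1 * D * (D * X) ^- 2 * Y ^- 2 =
  (C * D * (5^-1 * X) ^+ 2 * (5^-1 * Y) ^+ 2)^-1); last first.
  by field; rewrite !gt_eqF.
have pi1 : 1 <= pi ^+ 2 :> R by have := @pi_ge2 R; nra.
rewrite lef_pV2 ?posrE ?mulr_gt0 ?invr_gt0 ?exprn_gt0 ?pi_gt0//.
apply: ler_pM; rewrite ?mulr_ge0 ?invr_ge0 ?sqr_ge0 ?(ltW C0) ?(ltW D0) ?(ltW X0) ?(ltW Y0)//; last first.
  by rewrite ler_pXn2r ?nnegrE ?mulr_ge0 ?invr_ge0 ?(ltW Y0) ?(ltW n20)//; lra.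
apply: ler_pM; rewrite ?mulr_ge0 ?invr_ge0 ?sqr_ge0 ?(ltW C0) ?(ltW D0) ?(ltW X0) ?(ltW Y0)//; last first.
  by rewrite ler_pXn2r ?nnegrE ?mulr_ge0 ?invr_ge0 ?(ltW X0) ?(ltW n10)//; lra.
by rewrite ler_wpM2r ?(ltW D0)// ler_peMl ?(ltW C0).
Qed.

End kernel.

(** * Schur estimates on the Hartogs triangle *)

Section schur.
Variable R : realType.
Notation m2 := (@lebesgue_measure R \x @lebesgue_measure R)%E.
Implicit Types z w : C2 R.

Lemma gweight_gt0 b w : Hartogs R w -> 0 < gweight b w.
Proof.
move=> /andP[w12 w21].
have r0 : 0 < normc (z2 R w) by rewrite (le_lt_trans _ w12) ?normc_ge0.
rewrite /gweight !mulr_gt0 ?invr_gt0 ?powR_gt0 ?subr_gt0//.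
by rewrite ltr_pdivrMr// mul1r.
Qed.

(** The factor in [1 - |w1| / |w2|] is expressed by the distance [|w2| - |w1|] to the boundary of
    the fibre, the form in which [kernel_le] and the disc estimate are stated. *)
Lemma gweightE b w : Hartogs R w ->
  gweight b w = (normc (z2 R w))^-1 * normc (z2 R w) `^ b
    * (normc (z2 R w) - normc (z1 R w)) `^ (- b) * (1 - normc (z2 R w)) `^ (- b).
Proof.
move=> /andP[w12 w21].
have r0 : 0 < normc (z2 R w) by rewrite (le_lt_trans _ w12) ?normc_ge0.
rewrite /gweight; congr (_ * _); rewrite -mulrA; congr (_ * _).
rewrite (_ : 1 - _ / _ = (normc (z2 R w))^-1 * (normc (z2 R w) - normc (z1 R w))); last first.
  by field; rewrite gt_eqF.
rewrite powRM ?invr_ge0 ?subr_ge0 ?(ltW w12) ?(ltW r0)//; congr (_ * _).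
by rewrite -(powR_inv1 (ltW r0)) -powRrM mulN1r opprK.
Qed.

Lemma measurable_disc_kernel (r A a : R) (t : R[i]) :
  measurable_fun setT (fun s : RL R * RL R => (r - normc (s.1 +i* s.2)) `^ (- a) *
      (A + (r - normc (s.1 +i* s.2)) + normc (s.1 +i* s.2 - t)) ^- 2).
Proof.
have c1 : cmeasurable (fun s : RL R * RL R => s.1 +i* s.2) by apply: cmeasurable_pair; meas.
have n1 := measurable_normc c1.
have n2 := measurable_normc (cmeasurableB c1 (cmeasurable_cst _ t)).
by meas.
Qed.

Lemma measurable_disc (r : R) :
  measurable [set s : RL R * RL R | (normc (s.1 +i* s.2) < r)%R].
Proof.
have c1 : cmeasurable (fun s : RL R * RL R => s.1 +i* s.2) by apply: cmeasurable_pair; meas.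
by apply: (measurable_set_lt _ _ _ _ _ (measurable_normc c1)); exact: measurable_cst.
Qed.

Lemma mem_disc (r : R) (s : RL R * RL R) :
  (s \in [set s : RL R * RL R | (normc (s.1 +i* s.2) < r)%R]) = (normc (s.1 +i* s.2) < r).
Proof. by apply/idP/idP => [/set_mem|h]; last exact: mem_set. Qed.

(* At fixed [w2], the integral in [w1] is the disc estimate. *)
Lemma schur_kernel (b M : R) (phi : R[i] -> R) : 0 < b -> b < 1 ->
  (forall s, normc s < 1 -> 0 <= phi s) ->
  measurable_fun setT (fun s : RL R * RL R => phi (s.1 +i* s.2)) ->
  (forall u : R[i], normc u < 1 ->
     (\int[m2]_(s in [set s | (normc (s.1 +i* s.2) < 1)%R])
       (phi (s.1 +i* s.2) * ((1 - normc (s.1 +i* s.2)) `^ (- b) *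
      ((1 - normc u) + (1 - normc (s.1 +i* s.2)) + normc (s.1 +i* s.2 - u)) ^- 2))%:E
       <= (M * (1 - normc u) `^ (- b))%:E)%E) ->
  forall z, Hartogs R z ->
   (\int[vol4 R]_(w in Hartogs R)
      (normc (bergman_kernel R z w) * (gweight b w * phi (z2 R w)))%:E
    <= (625 * (216 * (1 - b)^-1 * b^-1) * M * gweight b z)%:E)%E.
Proof.
move=> b0 b1 phi0 mphi hphi z Hz; have /andP[z12 z21] := Hz.
pose rho := normc (z2 R z); pose t := z1 R z / z2 R z.
have rho0 : 0 < rho by rewrite /rho (le_lt_trans _ z12) ?normc_ge0.
have tE : normc t = normc (z1 R z) / rho by rewrite /t normcM normcV.
have t1 : 0 < 1 - normc t by rewrite tE subr_gt0 ltr_pdivrMr// mul1r.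
have [c cE c0] : exists2 c : R, c = 216 * (1 - b)^-1 * b^-1 & 0 <= c.
  exists (216 * (1 - b)^-1 * b^-1); first exact: erefl.
  rewrite -mulrA; apply: mulr_ge0; first exact: ler0n.
  by rewrite mulr_ge0 ?invr_ge0 ?subr_ge0 ?ltW.
have [k0 k0E k00] : exists2 k0 : R, k0 = 625 & 0 <= k0.
  by exists 625; [exact: erefl|exact: ler0n].
pose d2 (v : R[i]) := ((1 - rho) + (1 - normc v) + normc (v - z2 R z)) ^- 2.
pose d1 (u v : R[i]) :=
  (normc v * (1 - normc t) + (normc v - normc u) + normc (u - t * v)) ^- 2.
(* The majorant obtained from [kernel_le] and [gweightE], set to 0 off the triangle so that
   [integral_vol4] applies. The factor [|w2|] of the kernel bound has cancelled the [|w2|^-1] of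
   [gweight]. *)
pose E (u v : R[i]) : R := if normc u < normc v < 1 then
    (k0 * rho^-1 * (normc v `^ b * (1 - normc v) `^ (- b) * phi v * d2 v)) *
    ((normc v - normc u) `^ (- b) * d1 u v) else 0.
have d20 v : 0 <= d2 v by rewrite invr_ge0 sqr_ge0.
have d10 u v : 0 <= d1 u v by rewrite invr_ge0 sqr_ge0.
have E0 u v : 0 <= E u v.
  rewrite /E; case: ifP => // /andP[_ v1].
  by rewrite !mulr_ge0 ?powR_ge0 ?d20 ?d10 ?invr_ge0 ?phi0 ?(ltW rho0).
have mE : measurable_fun setT (fun w => E (z1 R w) (z2 R w)).
  have c1 := @cmeasurable_z1 R; have c2 := @cmeasurable_z2 R.
  have n1 := measurable_normc c1; have n2 := measurable_normc c2.
  have n3 := measurable_normc (cmeasurableB c2 (cmeasurable_cst _ (z2 R z))).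
  have n4 := measurable_normc (cmeasurableB c1 (cmeasurableM (cmeasurable_cst _ t) c2)).
  have mphi2 : measurable_fun setT (fun w => phi (z2 R w)).
    have mp : measurable_fun setT (fun w : C2 R => (w.1.2, w.2)).
      by apply: measurable_fun_pair; meas.
    exact: (measurableT_comp mphi mp).
  apply: measurable_fun_ifT; last by meas.
    by apply: measurable_and; apply: measurable_fun_ltr; first [exact: n1|exact: n2|exact: measurable_cst].
  by rewrite /d1 /d2; meas.
apply: (@le_trans _ _ (\int[vol4 R]_w (E (z1 R w) (z2 R w))%:E)%E).
  rewrite integral_mkcond; apply: le_lower_integral => w _.
    apply: erestrict_ge0 => {}w Hw; rewrite lee_fin; apply: mulr_ge0; first exact: normc_ge0.
    apply: mulr_ge0; first exact: ltW (gweight_gt0 b Hw).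
    by case/andP: Hw => _; exact: phi0.
  rewrite patchE; case: ifPn => [|_]; last by rewrite lee_fin.
  rewrite inE => Hw; have /andP[w12 w21] := Hw.
  have r0 : 0 < normc (z2 R w) by rewrite (le_lt_trans _ w12) ?normc_ge0.
  have g0 := ltW (gweight_gt0 b Hw).
  rewrite lee_fin /E w12 w21 /=.
  apply: (le_trans (ler_wpM2r (mulr_ge0 g0 (phi0 _ w21)) (kernel_le Hz Hw))).
  rewrite gweightE// le_eqVlt; apply/orP; left; apply/eqP.
  rewrite -/t -/rho -k0E -/(d1 (z1 R w) (z2 R w)) -/(d2 (z2 R w)).
  by field; rewrite !gt_eqF.
rewrite integral_vol4; last 2 first.
- exact/measurable_EFinP.
- by move=> w; rewrite lee_fin.
rewrite -[leLHS]/(\int[m2]_s \int[m2]_u (E (u.1 +i* u.2) (s.1 +i* s.2))%:E)%E.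
pose c2 := k0 * rho^-1 * c * (1 - normc t) `^ (- b).
have c20 : 0 <= c2 by rewrite !mulr_ge0 ?powR_ge0 ?invr_ge0 ?(ltW rho0).
apply: (@le_trans _ _ (\int[m2]_(s in [set s | (normc (s.1 +i* s.2) < 1)%R])
  (c2%:E * (phi (s.1 +i* s.2) * ((1 - normc (s.1 +i* s.2)) `^ (- b) *
      ((1 - rho) + (1 - normc (s.1 +i* s.2)) + normc (s.1 +i* s.2 - z2 R z)) ^- 2))%:E))%E).
  rewrite [leRHS]integral_mkcond; apply: le_lower_integral => s _.
    by apply: integral_ge0 => u _; rewrite lee_fin.
  rewrite patchE mem_disc; move: (s.1 +i* s.2) => v; case: ifPn => v1; last first.
    by rewrite integral0_eq// => u _; rewrite /E (negbTE v1) andbF.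
  (* Over [v = 0] the fibre is empty. *)
  have [v0|v0] := eqVneq (normc v) 0.
    rewrite integral0_eq; last first.
      by move=> u _; rewrite /E v0 ltNge normc_ge0.
    by rewrite -EFinM lee_fin !mulr_ge0 ?powR_ge0 ?phi0 ?invr_ge0 ?sqr_ge0 ?(ltW rho0).
  have {}v0 : 0 < normc v by rewrite lt_neqAle eq_sym v0 normc_ge0.
  pose k := k0 * rho^-1 * (normc v `^ b * (1 - normc v) `^ (- b) * phi v * d2 v).
  have kge0 : 0 <= k by rewrite !mulr_ge0 ?powR_ge0 ?d20 ?d20 ?d10 ?invr_ge0 ?phi0 ?(ltW rho0).
  apply: (@le_trans _ _ (\int[m2]_(u in [set u | (normc (u.1 +i* u.2) < normc v)%R])
    (k%:E * ((normc v - normc (u.1 +i* u.2)) `^ (- b) *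
      (normc v * (1 - normc t) + (normc v - normc (u.1 +i* u.2)) +
       normc (u.1 +i* u.2 - t * v)) ^- 2)%:E))%E).
    rewrite [leRHS]integral_mkcond; apply: le_lower_integral => u _; first by rewrite lee_fin.
    rewrite patchE mem_disc /E v1 andbT; move: (u.1 +i* u.2) => {}u.
    by case: ifP => // _; rewrite -EFinM.
  rewrite ge0_integralZl_EFin; [|exact: measurable_disc| | |exact: kge0]; last 2 first.
  - by move=> u _; rewrite lee_fin mulr_ge0 ?powR_ge0 ?invr_ge0 ?sqr_ge0.
  - by apply/measurable_EFinP; apply/(measurable_funS _ (subsetT _)) => //;
      exact: measurable_disc_kernel.
  (* The disc estimate is applied on the fibre with radius [|v|], centre [t v] and
     [A = |v| (1 - |t|)]. The factor [|v|^-b] of [A^-b] cancels the [|v|^b] in [k], so no power of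
     [|v|] remains. *)
  have A0 : 0 < normc v * (1 - normc t) by rewrite mulr_gt0.
  apply: (le_trans (lee_wpmul2l _ (integral_disc_kernel R _ _ _ (t * v) v0 A0 b0 b1))).
    by rewrite lee_fin.
  rewrite -!EFinM lee_fin (powRM _ (ltW v0) (ltW t1)) powRN.
  rewrite le_eqVlt; apply/orP; left; apply/eqP; rewrite /k /c2 -cE /d2.
  have vb0 : normc v `^ b != 0 by rewrite gt_eqF// powR_gt0.
  by rewrite -[RHS]mulr1 -[X in _ = _ * X](mulfV vb0); ring.
rewrite ge0_integralZl_EFin; [|exact: measurable_disc| | |exact: c20]; last 2 first.
- by move=> u u1; rewrite lee_fin !mulr_ge0 ?powR_ge0 ?invr_ge0 ?sqr_ge0 ?phi0.
- apply/measurable_EFinP; apply/(measurable_funS _ (subsetT _)) => //.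
  by apply: measurable_funM => //; exact: measurable_disc_kernel.
apply: (le_trans (lee_wpmul2l _ (hphi _ z21))); first by rewrite lee_fin.
rewrite -!EFinM lee_fin le_eqVlt; apply/orP; left; apply/eqP.
by rewrite /c2 /gweight tE -k0E -cE -/rho; ring.
Qed.

End schur.

Section schur_instances.
Variable R : realType.
Notation m2 := (@lebesgue_measure R \x @lebesgue_measure R)%E.
Implicit Types z w : C2 R.

Lemma falpha_gt0 (alpha : R) (j : nat) (v : R[i]) : (0 < j)%N ->
  0 < normc v -> normc v < 1 -> 0 < falpha R alpha j v.
Proof.
by move=> j0 v0 v1; rewrite falphaE mulr_gt0 ?invr_gt0 ?exprn_gt0 ?psi_gt0.
Qed.

Lemma falpha_ge0 (alpha : R) (j : nat) (v : R[i]) : (0 < j)%N ->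
  normc v < 1 -> 0 <= falpha R alpha j v.
Proof.
move=> j0 v1; have [v0|v0] := eqVneq (normc v) 0.
  by rewrite falphaE v0 expr0n/= invr0 mul0r.
by apply/ltW/falpha_gt0 => //; rewrite lt_neqAle eq_sym v0 normc_ge0.
Qed.

Lemma measurable_falpha d (T : measurableType d) (alpha : R) (j : nat) (F : T -> R[i]) :
  cmeasurable F -> measurable_fun setT (fun s => falpha R alpha j (F s)).
Proof.
move=> mF; have n1 := measurable_normc mF.
apply: (eq_measurable_fun (fun s => (normc (F s) ^+ 2)^-1 * psi R alpha j (normc (F s)))).
  by move=> s _; rewrite falphaE.
apply: measurable_funM; last exact: measurable_psi.
by apply: measurable_fun_inv; exact: measurable_funX.
Qed.

Let kernel1 (b : R) (u v : R[i]) : R := (1 - normc v) `^ (- b) *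
      ((1 - normc u) + (1 - normc v) + normc (v - u)) ^- 2.

Let kernel1_ge0 b u v : 0 <= kernel1 b u v.
Proof. by rewrite mulr_ge0 ?powR_ge0 ?invr_ge0 ?sqr_ge0. Qed.

Let integral_kernel1 b u : 0 < b -> b < 1 -> normc u < 1 ->
  (\int[m2]_(s in [set s | (normc (s.1 +i* s.2) < 1)%R]) (kernel1 b u (s.1 +i* s.2))%:E
   <= (216 * (1 - b)^-1 * b^-1 * (1 - normc u) `^ (- b))%:E)%E.
Proof.
by move=> b0 b1 u1; apply: integral_disc_kernel => //; rewrite subr_gt0.
Qed.

(** The case [phi = 1] of [schur_kernel]: the integral left in [w2] is again the disc estimate, with
    radius 1 and [A = 1 - |u|]. *)
Lemma schur_gweight (b : R) : 0 < b -> b < 1 -> exists C : R, 0 < C /\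
  forall z, Hartogs R z ->
   (\int[vol4 R]_(w in Hartogs R)
      (normc (bergman_kernel R z w) * gweight b w)%:E <= (C * gweight b z)%:E)%E.
Proof.
move=> b0 b1.
exists (625 * (216 * (1 - b)^-1 * b^-1) * (216 * (1 - b)^-1 * b^-1)); split.
  have c0 : 0 < 216 * (1 - b)^-1 * b^-1.
    rewrite -mulrA; apply: mulr_gt0; first by rewrite ltr0n.
    by rewrite mulr_gt0 ?invr_gt0 ?subr_gt0.
  have k0 : (0 : R) < 625 by rewrite ltr0n.
  exact: mulr_gt0 (mulr_gt0 k0 c0) c0.
move=> z Hz.
have := @schur_kernel R b (216 * (1 - b)^-1 * b^-1) (fun=> 1) b0 b1.
move=> /(_ (fun _ _ => ler01) (measurable_cst _)) H.
apply: (le_trans _ (H _ z Hz)).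
  apply: le_lower_integral => w Hw.
    by rewrite lee_fin; apply: mulr_ge0; [exact: normc_ge0|exact: ltW (gweight_gt0 b Hw)].
  by rewrite mulr1.
move=> u u1; apply: (le_trans _ (integral_kernel1 b0 b1 u1)).
apply: le_lower_integral => s s1; rewrite lee_fin mul1r; last exact: lexx.
exact: kernel1_ge0.
Qed.

(** The unit disc is cut at radius 1/4. Outside, [falpha] is at most 16 and the disc estimate
    applies; inside, the one-variable kernel is at most 3 and the integrability of [falpha] at the
    origin applies. *)
Lemma schur_falpha (alpha b : R) (j : nat) : alpha < -1 -> 0 < b -> b < 1 ->
  exists C : R, 0 < C /\ forall z, Hartogs R z ->
   (\int[vol4 R]_(w in Hartogs R)
      (normc (bergman_kernel R z w) * (gweight b w * falpha R alpha j.+1 (z2 R w)))%:E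
    <= (C * gweight b z)%:E)%E.
Proof.
move=> al b0 b1.
have al0 : alpha <= 0 by lra.
have [c cE c0] : exists2 c : R, c = 216 * (1 - b)^-1 * b^-1 & 0 < c.
  exists (216 * (1 - b)^-1 * b^-1); first exact: erefl.
  rewrite -mulrA; apply: mulr_gt0; first by rewrite ltr0n.
  by rewrite mulr_gt0 ?invr_gt0 ?subr_gt0.
have [e eE e0] : exists2 e : R, e = 8 * (2 ^+ j * (- (alpha + 1))^-1) & 0 <= e.
  exists (8 * (2 ^+ j * (- (alpha + 1))^-1)); first exact: erefl.
  apply: mulr_ge0; first exact: ler0n.
  by apply: mulr_ge0; [exact: exprn_ge0|rewrite invr_ge0; lra].
(* [c] is the constant of the disc estimate and [e] the bound on the integral of [falpha] over
   [|v| < 1/4]. *)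
pose M := 16 * c + 3 * e.
have M0 : 0 < M by rewrite /M; lra.
exists (625 * c * M); split.
  have k0 : (0 : R) < 625 by rewrite ltr0n.
  exact: mulr_gt0 (mulr_gt0 k0 c0) M0.
move=> z Hz; rewrite cE.
apply: (@schur_kernel R b M (falpha R alpha j.+1) b0 b1 _ _ _ z Hz).
- by move=> v v1; exact: falpha_ge0.
- by apply: measurable_falpha; apply: cmeasurable_pair; meas.
move=> {z Hz} u u1.
have u0 := normc_ge0 _ u.
have c1 : cmeasurable (fun s : RL R * RL R => s.1 +i* s.2) by apply: cmeasurable_pair; meas.
pose D1 := [set s : RL R * RL R | (normc (s.1 +i* s.2) < 1)%R].
pose D4 := [set s : RL R * RL R | (normc (s.1 +i* s.2) < 4^-1)%R].
pose f1 (s : RL R * RL R) := (16%:E * (kernel1 b u (s.1 +i* s.2))%:E)%E.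
pose f2 (s : RL R * RL R) := (3%:E * (falpha R alpha j.+1 (s.1 +i* s.2))%:E)%E.
have mf1 D : measurable_fun D (fun s => (kernel1 b u (s.1 +i* s.2))%:E).
  apply/measurable_EFinP; apply/(measurable_funS _ (subsetT _)) => //.
  exact: measurable_disc_kernel.
have mf2 D : measurable_fun D (fun s => (falpha R alpha j.+1 (s.1 +i* s.2))%:E).
  apply/measurable_EFinP; apply/(measurable_funS _ (subsetT _)) => //.
  exact: measurable_falpha.
have mD1 : measurable D1 by exact: measurable_disc.
have mD4 : measurable D4 by exact: measurable_disc.
have mg1 : measurable_fun setT (f1 \_ D1).
  by apply/(measurable_restrictT f1) => //; exact: (measurable_funeM _ (mf1 D1)).
have mg2 : measurable_fun setT (f2 \_ D4).
  by apply/(measurable_restrictT f2) => //; exact: (measurable_funeM _ (mf2 D4)).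
have g10 s : (0 <= (f1 \_ D1) s)%E.
  apply: erestrict_ge0 => {}s _; apply: mule_ge0; rewrite lee_fin ?ler0n//.
have g20 s : (0 <= (f2 \_ D4) s)%E.
  apply: erestrict_ge0 => {}s s4; apply: mule_ge0; rewrite lee_fin ?ler0n//.
  by apply: falpha_ge0 => //; have : normc (s.1 +i* s.2) < 4^-1 := s4; lra.
apply: (@le_trans _ _ (\int[m2]_s ((f1 \_ D1) s + (f2 \_ D4) s))%E).
  rewrite integral_mkcond; apply: le_lower_integral => s _.
    apply: erestrict_ge0 => {}s s1; rewrite lee_fin; apply: mulr_ge0.
      exact: falpha_ge0.
    exact: kernel1_ge0.
  rewrite !patchE !mem_disc /f1 /f2 -/(kernel1 b u (s.1 +i* s.2)).
  move: (s.1 +i* s.2) => v; case: ifPn => v1; last first.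
    case: ifPn => // v4; last by rewrite adde0.
    by move: v1; rewrite (lt_trans v4)// invf_lt1// ltr1n.
  have k0 := kernel1_ge0 b u v.
  have a0 : 0 <= falpha R alpha j.+1 v by exact: falpha_ge0.
  case: ifPn => [v4|]; last first.
    rewrite -leNgt => v4; rewrite adde0 -EFinM lee_fin; apply: ler_wpM2r => //.
    have v0 : 0 < normc v by apply: lt_le_trans v4; rewrite invr_gt0.
    have p1 : psi R alpha j.+1 (normc v) <= 1 by exact: psi_le1.
    rewrite falphaE -[leRHS]mulr1; apply: ler_pM => //.
    - by rewrite invr_ge0 sqr_ge0.
    - by rewrite ltW// psi_gt0.
    - rewrite -[16]invrK lef_pV2 ?posrE ?exprn_gt0 ?invr_gt0//.
      by rewrite (_ : 16^-1 = 4^-1 ^+ 2); [rewrite ler_pXn2r ?nnegrE ?invr_ge0 ?normc_ge0|field].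
  rewrite -!EFinM -EFinD lee_fin.
  apply: (@le_trans _ _ (3 * falpha R alpha j.+1 v)); last first.
    by rewrite lerDr; apply: mulr_ge0 => //; exact: ler0n.
  rewrite mulrC; apply: ler_wpM2r => //.
  (* From [1 - |v| > 3/4] the power is at most [(3/2)^b <= 3/2], and the squared denominator is at
     least [9/16 >= 1/2]. *)
  rewrite /kernel1 (_ : 3 = 3 / 2 * 2); last by field.
  have n0 := normc_ge0 _ (v - u).
  apply: ler_pM; rewrite ?powR_ge0 ?invr_ge0 ?sqr_ge0//.
    apply: (@le_trans _ _ ((2 / 3) `^ (- b))).
      apply: ger0_lepowRN; lra.
    have h32 : (0 : R) <= 3 / 2 by lra.
    have -> : (2 / 3 : R) = (3 / 2) `^ (-1) by rewrite powR_inv1// invf_div.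
    rewrite -powRrM mulN1r opprK -[leRHS](powRr1 h32).
    by apply: ler_powR; lra.
  rewrite -[2]invrK lef_pV2 ?posrE ?exprn_gt0 ?invr_gt0//; last by lra.
  nra.
rewrite ge0_integralD//; try by move=> s _.
rewrite -!integral_mkcond /f1 /f2.
rewrite ge0_integralZl_EFin; [|exact: mD1| |exact: mf1|exact: ler0n]; last first.
  by move=> s _; rewrite lee_fin; exact: kernel1_ge0.
rewrite ge0_integralZl_EFin; [|exact: mD4| |exact: mf2|exact: ler0n]; last first.
  move=> s s4; rewrite lee_fin; apply: falpha_ge0 => //.
  by have : normc (s.1 +i* s.2) < 4^-1 := s4; lra.
have i1 := integral_kernel1 b0 b1 u1; rewrite -cE in i1.
have i2 := integral_falpha_le R alpha j al; rewrite -eE in i2.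
(* The contribution near the origin is a plain constant; it is absorbed into the required form
   because this power is at least 1. *)
have p1 : 1 <= (1 - normc u) `^ (- b).
  rewrite [leLHS](_ : _ = 1 `^ (- b)); last by rewrite powR1.
  by apply: ger0_lepowRN; lra.
apply: (@le_trans _ _ (16%:E * (c * (1 - normc u) `^ (- b))%:E + 3%:E * e%:E)%E).
  by apply: leeD; apply: lee_wpmul2l => //; rewrite lee_fin ler0n.
rewrite -!EFinM -EFinD lee_fin /M.
move: (_ `^ _) p1 => p p1; have h : e <= e * p by rewrite ler_peMr.
lra.
Qed.

End schur_instances.

(** * The weak-type bound *)

Section truncation.
Variable R : realType.
Implicit Types z w : C2 R.

Local Notation k z w := (normc (bergman_kernel R z w)).

Lemma measurable_Hartogs : measurable (Hartogs R).
Proof.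
have n1 := measurable_normc (@cmeasurable_z1 R).
have n2 := measurable_normc (@cmeasurable_z2 R).
have -> : Hartogs R = [set w | normc (z1 R w) < normc (z2 R w)] `&`
                      [set w | normc (z2 R w) < cst 1 w].
  by apply/seteqP; split => w; [move=> /andP[]|move=> [h1 h2]; apply/andP].
apply: measurableI; apply: measurable_set_lt => //.
Qed.

Lemma measurable_gweight b : measurable_fun setT (@gweight R b).
Proof.
have n1 := measurable_normc (@cmeasurable_z1 R).
have n2 := measurable_normc (@cmeasurable_z2 R).
by rewrite /gweight; meas.
Qed.

Lemma measurable_kernel_norm : measurable_fun setT (fun p : C2 R * C2 R => k p.1 p.2).
Proof. exact: measurable_normc (@cmeasurable_kernel R). Qed.

Lemma measurable_kernel_norm1 z : measurable_fun setT (fun w => k z w).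
Proof.
have mz : measurable_fun setT (fun w : C2 R => (z, w)).
  by apply: measurable_fun_pair; meas.
exact: (measurableT_comp measurable_kernel_norm mz).
Qed.

(** The boundary factors agree exactly; the only loss is [|w2|^(-1/3) <= |w2|^-1], valid since
    [|w2| < 1]. *)
Lemma gweight_root (a : R) w : Hartogs R w ->
  gweight a w `^ (1 / 3%:R) <= gweight (a / 3%:R) w.
Proof.
move=> Hw; have /andP[w12 w21] := Hw.
have r0 : 0 < normc (z2 R w) by rewrite (le_lt_trans _ w12) ?normc_ge0.
have q1 : 0 < 1 - normc (z1 R w) / normc (z2 R w).
  by rewrite subr_gt0 ltr_pdivrMr// mul1r.
have q2 : 0 < 1 - normc (z2 R w) by rewrite subr_gt0.
rewrite /gweight; move: (normc (z2 R w)) (1 - _) (1 - _) r0 w21 q1 q2 => r p q r0 r1 p0 q0.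
rewrite powRM ?mulr_ge0 ?powR_ge0 ?invr_ge0 ?(ltW r0)//.
rewrite powRM ?powR_ge0 ?invr_ge0 ?(ltW r0)//.
rewrite -!powRrM !mulNr mul1r; apply: ler_wpM2r; first exact: powR_ge0.
apply: ler_wpM2r; first exact: powR_ge0.
rewrite -[leRHS]powRr1 ?invr_ge0 ?(ltW r0)//; apply: ler_powR; last by lra.
by rewrite invf_ge1// ltW.
Qed.

(** The exponents [- a / 3] and [a / 3] cancel in both boundary factors, and the powers of [|w2|]
    combine to [-1 + 1/3 = -2/3], which is [(|w2|^2)^(-1/3)]. *)
Lemma gweight_mu (a alpha : R) (j : nat) w : (0 < j)%N -> Hartogs R w ->
  gweight (a / 3%:R) w * (gweight a w * falpha R alpha j (z2 R w)) `^ (- (1 / 3%:R))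
  = mu_weight R alpha j w.
Proof.
move=> j0 Hw; have /andP[w12 w21] := Hw.
have r0 : 0 < normc (z2 R w) by rewrite (le_lt_trans _ w12) ?normc_ge0.
have q1 : 0 < 1 - normc (z1 R w) / normc (z2 R w).
  by rewrite subr_gt0 ltr_pdivrMr// mul1r.
have q2 : 0 < 1 - normc (z2 R w) by rewrite subr_gt0.
have f0 := falpha_gt0 alpha j0 r0 w21.
rewrite /mu_weight /gweight.
move: (normc (z2 R w)) (falpha _ _ _ _) (1 - _) (1 - _) r0 w21 f0 q1 q2.
move=> r f p q r0 r1 f0 p0 q0.
rewrite powRM ?mulr_ge0 ?powR_ge0 ?invr_ge0 ?(ltW r0) ?(ltW f0)//.
rewrite powRM ?mulr_ge0 ?powR_ge0 ?invr_ge0 ?(ltW r0)//.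
rewrite powRM ?powR_ge0 ?invr_ge0 ?(ltW r0)//.
rewrite [RHS]powRM ?sqr_ge0 ?(ltW f0)//.
have e (x : R) : 0 < x -> x `^ (- (a / 3)) * (x `^ (- a)) `^ (- (1 / 3)) = 1.
  move=> x0; rewrite -powRrM -powRD; last by rewrite (gt_eqF x0) implybT.
  by rewrite (_ : _ + _ = 0) ?powRr0//; ring.
have er : r^-1 * (r^-1) `^ (- (1 / 3)) = (r ^+ 2) `^ (- (1 / 3)).
  rewrite -(powR_mulrn _ (ltW r0)) -(powR_inv1 (ltW r0)) -!powRrM -powRD.
    by congr powR; field.
  by rewrite (gt_eqF r0) implybT.
have rearrange (u p1 q1 v p2 q2 F : R) :
  u * p1 * q1 * (v * p2 * q2 * F) = u * v * F * (p1 * p2) * (q1 * q2) by ring.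
rewrite -er rearrange.
by rewrite !e// !mulr1.
Qed.

(** Above the height [c], write [x = x^(-1/3) x^(4/3)] and use [x^(-1/3) <= c^(-1/3)]. *)
Lemma le_threshold (x c : R) : 0 <= x -> 0 < c ->
  x <= c + c `^ (- (1 / 3%:R)) * x `^ (4%:R / 3%:R).
Proof.
move=> x0 c0; have [xc|cx] := leP x c.
  by rewrite (le_trans xc)// lerDl mulr_ge0 ?powR_ge0.
have xp := lt_trans c0 cx.
apply: (@le_trans _ _ (c `^ (- (1 / 3%:R)) * x `^ (4%:R / 3%:R))); last first.
  by rewrite lerDr ltW.
rewrite [leLHS](_ : _ = x `^ (- (1 / 3%:R)) * x `^ (4%:R / 3%:R)); last first.
  rewrite -powRD; last by rewrite (gt_eqF xp) implybT.
  by rewrite (_ : _ + _ = 1) ?powRr1//; field.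
apply: ler_wpM2r; first exact: powR_ge0.
by apply: ger0_lepowRN => //; exact: ltW.
Qed.

(* The function is cut at the height [c = eps lambda U(w) / V(z)], which makes the
   contribution of the small part at most [lambda / 2]. *)
Lemma pointwise_bound (C lambda V : R) (z : C2 R) (U phi : C2 R -> R) :
  0 < C -> 0 < lambda -> 0 < V ->
  (forall w, Hartogs R w -> 0 < U w) -> measurable_fun setT U ->
  (forall w, 0 <= phi w) -> measurable_fun setT phi ->
  (\int[vol4 R]_(w in Hartogs R) (k z w * U w)%:E <= (C * V)%:E)%E ->
  (lambda%:E < 2%:E * \int[vol4 R]_(w in Hartogs R) (k z w * phi w)%:E)%E ->
  ((lambda `^ (4%:R / 3%:R))%:E <=
    (4 * (4 * C) `^ (1 / 3%:R))%:E * ((V `^ (1 / 3%:R))%:E *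
    \int[vol4 R]_(w in Hartogs R)
       (k z w * (U w `^ (- (1 / 3%:R)) * phi w `^ (4%:R / 3%:R)))%:E))%E.
Proof.
move=> C0 l0 V0 U0 mU phi0 mphi hU hl.
have mk := measurable_kernel_norm1 z.
(* With this height the small part contributes at most [lambda / 4] to the integral, hence
   [lambda / 2] after the factor 2 of the hypothesis. *)
pose e := lambda / (4 * C * V).
have e0 : 0 < e by rewrite divr_gt0// !mulr_gt0.
pose d := e `^ (- (1 / 3%:R)).
have d0 : 0 <= d by exact: powR_ge0.
set X := (\int[vol4 R]_(w in Hartogs R) (k z w * U w)%:E)%E in hU.
set Y := (\int[vol4 R]_(w in Hartogs R)
       (k z w * (U w `^ (- (1 / 3%:R)) * phi w `^ (4%:R / 3%:R)))%:E)%E.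
have Y0 : (0 <= Y)%E.
  apply: integral_ge0 => w Hw; rewrite lee_fin; apply: mulr_ge0; first exact: normc_ge0.
  by apply: mulr_ge0; exact: powR_ge0.
have m1 : measurable_fun (Hartogs R) (fun w => (k z w * U w)%:E).
  apply/measurable_EFinP; apply/(measurable_funS _ (subsetT _)) => //.
  exact: measurable_funM.
have m2 : measurable_fun (Hartogs R)
    (fun w => (k z w * (U w `^ (- (1 / 3%:R)) * phi w `^ (4%:R / 3%:R)))%:E).
  apply/measurable_EFinP; apply/(measurable_funS _ (subsetT _)) => //.
  by apply: measurable_funM => //; apply: measurable_funM; exact: measurable_fun_powR.
have mH := measurable_Hartogs.
have p1 w : Hartogs R w -> (0 <= (k z w * U w)%:E)%E.
  move=> Hw; rewrite lee_fin; apply: mulr_ge0; first exact: normc_ge0.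
  exact: ltW (U0 _ Hw).
have p2 w : Hartogs R w ->
    (0 <= (k z w * (U w `^ (- (1 / 3%:R)) * phi w `^ (4%:R / 3%:R)))%:E)%E.
  move=> Hw; rewrite lee_fin; apply: mulr_ge0; first exact: normc_ge0.
  by apply: mulr_ge0; exact: powR_ge0.
have hT : (\int[vol4 R]_(w in Hartogs R) (k z w * phi w)%:E <= e%:E * X + d%:E * Y)%E.
  apply: (@le_trans _ _ (\int[vol4 R]_(w in Hartogs R) (e%:E * (k z w * U w)%:E +
     d%:E * (k z w * (U w `^ (- (1 / 3%:R)) * phi w `^ (4%:R / 3%:R)))%:E))%E).
    apply: le_lower_integral => w Hw.
      by rewrite lee_fin; apply: mulr_ge0; [exact: normc_ge0|exact: phi0].
    rewrite -!EFinM -EFinD lee_fin !(mulrCA _ (k z w)) -mulrDr.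
    apply: ler_wpM2l; first exact: normc_ge0.
    have eU : 0 < e * U w by rewrite mulr_gt0// U0.
    apply: (le_trans (le_threshold (phi0 w) eU)).
    by rewrite (powRM _ (ltW e0) (ltW (U0 _ Hw))) mulrA.
  rewrite ge0_integralD//; last 4 first.
  - by move=> w Hw; apply: mule_ge0; [rewrite lee_fin ltW|exact: p1].
  - exact: measurable_funeM.
  - by move=> w Hw; apply: mule_ge0; [rewrite lee_fin|exact: p2].
  - exact: measurable_funeM.
  rewrite (ge0_integralZl_EFin _ mH p1 m1 (ltW e0)).
  by rewrite (ge0_integralZl_EFin _ mH p2 m2 d0).
have hX : (e%:E * X <= (lambda / 4)%:E)%E.
  apply: (le_trans (lee_wpmul2l _ hU)); first by rewrite lee_fin ltW.
  rewrite -EFinM lee_fin le_eqVlt; apply/orP; left; apply/eqP; rewrite /e.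
  by field; rewrite !gt_eqF.
have lY : (lambda%:E <= (4 * d)%:E * Y)%E.
  have : (lambda%:E <= 2%:E * ((lambda / 4)%:E + d%:E * Y))%E.
    apply: (le_trans (ltW hl)); apply: lee_wpmul2l => //.
    by apply: (le_trans hT); apply: leeD.
  have : (0 <= d%:E * Y)%E by apply: mule_ge0; rewrite ?lee_fin.
  (* [Y] may be infinite, so [lambda / 2] is moved to the left only in the finite case. *)
  rewrite (EFinM 4 d) -muleA; case: (d%:E * Y)%E => [y| |]//.
    by rewrite -EFinD -!EFinM !lee_fin => y0 h; lra.
  by move=> _ _; rewrite mulry gtr0_sg ?ltr0n// mul1e leey.
(* The missing power of [lambda] comes from [d]: [lambda^(1/3) d = (4 C V)^(1/3)]. *)
rewrite [leLHS](_ : _ = (lambda `^ (1 / 3%:R))%:E * lambda%:E)%E; last first.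
  rewrite -EFinM -[X in _ = (_ * X)%:E](powRr1 (ltW l0)) -powRD.
    by congr (_ `^ _)%:E; field.
  by rewrite (gt_eqF l0) implybT.
apply: (@le_trans _ _ ((lambda `^ (1 / 3%:R))%:E * ((4 * d)%:E * Y))%E).
  by apply: lee_wpmul2l => //; rewrite lee_fin powR_ge0.
rewrite !muleA -!EFinM; apply: lee_wpmul2r => //; rewrite lee_fin.
rewrite le_eqVlt; apply/orP; left; apply/eqP.
have CV : 0 <= 4 * C * V by rewrite !mulr_ge0 ?ltW.
have C4 : 0 <= 4 * C by rewrite mulr_ge0 ?ltW.
rewrite /d /e powRM ?invr_ge0 ?(ltW l0)// -(powR_inv1 CV) -powRrM mulN1r opprK.
rewrite (powRM _ C4 (ltW V0)).
rewrite [LHS](_ : _ = (lambda `^ (1 / 3) * lambda `^ (- (1 / 3))) *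
   (4 * ((4 * C) `^ (1 / 3) * V `^ (1 / 3)))); last by ring.
by rewrite powRN mulfV ?mul1r ?mulrA// gt_eqF// powR_gt0.
Qed.

End truncation.

(** * Real-valued integrals with a parameter, and the Tonelli half of Schur's test *)

Section integral_operators.
Variable R : realType.

(** Integrability is not assumed: when the extended integral is infinite, the left side is 0 by the
    convention of [fine]. *)
Lemma le_abs_Rintegral d (T : measurableType d) (mu : {measure set T -> \bar R})
    (D : set T) (g : T -> R) : measurable D -> measurable_fun D g ->
  ((`|Rintegral mu D g|)%:E <= \int[mu]_(x in D) (`|g x|)%:E)%E.
Proof.
move=> mD mg; have mG : measurable_fun D (EFin \o g) by exact/measurable_EFinP.
apply: (le_trans _ (le_abse_integral mu mD mG)).
by rewrite /Rintegral; case: (\int[mu]_(x in D) _)%E => //=; rewrite normr0 leey.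
Qed.

(** Tonelli's measurability statement is applied to the positive and negative parts separately, so
    sections that are not integrable are allowed. *)
Lemma measurable_Rintegral_section d1 d2 (T1 : measurableType d1)
    (T2 : measurableType d2) (mu : {sigma_finite_measure set T2 -> \bar R})
    (g : T1 * T2 -> R) : measurable_fun setT g ->
  measurable_fun setT (fun x => Rintegral mu setT (fun y => g (x, y))).
Proof.
move=> mg; have mG : measurable_fun setT (fun p => (g p)%:E) by exact/measurable_EFinP.
apply: (measurableT_comp (fine_measurable measurableT)).
pose F p := (g p)%:E.
apply: (eq_measurable_fun (fun x => \int[mu]_y (F^\+%E (x, y)) - \int[mu]_y (F^\-%E (x, y)))%E).
  move=> x _; rewrite integralE; congr (_ - _)%E; apply: eq_integral => y _.
    by rewrite !funeposE.
  by rewrite !funenegE.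
apply: emeasurable_funB.
  apply: (@measurable_fun_fubini_tonelli_F _ _ _ _ _ mu F^\+%E) => //.
  exact: measurable_funepos.
apply: (@measurable_fun_fubini_tonelli_F _ _ _ _ _ mu F^\-%E) => //.
exact: measurable_funeneg.
Qed.

(** After exchanging the order of integration, the inner integral in [z] is exactly the one bounded
    by the hypothesis on [K] and [G]. *)
Lemma schur_tonelli d (T : measurableType d) (mu : {sigma_finite_measure set T -> \bar R})
    (D : set T) (K : T -> T -> R) (G psi : T -> R) (C : R) :
  measurable D -> measurable_fun setT (fun p : T * T => K p.1 p.2) ->
  (forall z w, 0 <= K z w) -> (forall z, D z -> 0 <= G z) -> measurable_fun setT G ->
  (forall w, D w -> (\int[mu]_(z in D) (K z w * G z)%:E <= (C * G w)%:E)%E) ->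
  0 <= C -> (forall w, 0 <= psi w) -> measurable_fun setT psi ->
  (\int[mu]_(z in D) ((G z)%:E * \int[mu]_(w in D) (K z w * psi w)%:E)
   <= C%:E * \int[mu]_(w in D) (G w * psi w)%:E)%E.
Proof.
move=> mD mK K0 G0 mG hC C0 psi0 mpsi.
have mGD : measurable_fun setT (G \_ D) by exact: measurable_fun_patch.
have mpD : measurable_fun setT (psi \_ D) by exact: measurable_fun_patch.
have GD0 z : 0 <= (G \_ D) z.
  by rewrite patchE; case: ifPn => //; rewrite inE => Dz; exact: G0.
have pD0 z : 0 <= (psi \_ D) z by rewrite patchE; case: ifPn.
have mK1 z : measurable_fun setT (fun w => K z w).
  have mz : measurable_fun setT (fun w : T => (z, w)) by apply: measurable_fun_pair; meas.
  exact: (measurableT_comp mK mz).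
have mK2 w : measurable_fun setT (fun z => K z w).
  have mw : measurable_fun setT (fun z : T => (z, w)) by apply: measurable_fun_pair; meas.
  exact: (measurableT_comp mK mw).
(* Cutting [G] and [psi] off outside [D] turns both integrals into integrals over the whole
   space. *)
pose J (p : T * T) : \bar R := ((G \_ D) p.1 * (K p.1 p.2 * (psi \_ D) p.2))%:E.
have mJ : measurable_fun setT J.
  apply/measurable_EFinP; apply: measurable_funM.
    exact: (measurableT_comp mGD measurable_fst).
  by apply: measurable_funM => //; exact: (measurableT_comp mpD measurable_snd).
have J0 p : (0 <= J p)%E by rewrite lee_fin !mulr_ge0.
apply: (@le_trans _ _ (\int[mu]_z \int[mu]_w J (z, w))%E).
  rewrite integral_mkcond; apply: le_lower_integral => z _.
    apply: erestrict_ge0 => {}z Dz; apply: mule_ge0; first by rewrite lee_fin G0.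
    by apply: integral_ge0 => w _; rewrite lee_fin mulr_ge0.
  rewrite patchE; case: ifPn => Dz; last exact: integral_ge0.
  rewrite inE in Dz.
  rewrite -ge0_integralZl_EFin//; last 3 first.
  - by move=> w _; rewrite lee_fin mulr_ge0.
  - by apply/measurable_EFinP; apply: measurable_funTS; exact: measurable_funM.
  - exact: G0.
  rewrite integral_mkcond; apply: le_lower_integral => w _.
    by apply: erestrict_ge0 => {}w _; rewrite -EFinM lee_fin !mulr_ge0// G0.
  rewrite /J !patchE /= (mem_set Dz); case: ifPn => _; first by rewrite EFinM.
  by rewrite !mulr0.
rewrite (@fubini_tonelli _ _ _ _ R mu mu J mJ J0).
rewrite -ge0_integralZl_EFin//; last 2 first.
- by move=> w Dw; rewrite lee_fin mulr_ge0// G0.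
- by apply/measurable_EFinP; apply: measurable_funTS; exact: measurable_funM.
rewrite [leRHS]integral_mkcond; apply: le_lower_integral => w _; first exact: integral_ge0.
rewrite patchE; case: ifPn => Dw; last first.
  by rewrite integral0_eq// => z _; rewrite /J !patchE /= (negbTE Dw) !mulr0.
rewrite inE in Dw.
apply: (@le_trans _ _ (\int[mu]_(z in D) ((psi w)%:E * (K z w * G z)%:E))%E).
  rewrite [leRHS]integral_mkcond; apply: le_lower_integral => z _; first exact: J0.
  rewrite /J !patchE /= (mem_set Dw); case: ifPn => _; last by rewrite mul0r.
  by rewrite -EFinM lee_fin [leLHS]mulrCA [G z * psi w]mulrC [leLHS]mulrCA.
rewrite ge0_integralZl_EFin//; last 2 first.
- by move=> z Dz; rewrite lee_fin mulr_ge0// G0.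
- by apply/measurable_EFinP; apply: measurable_funTS; exact: measurable_funM.
apply: (le_trans (lee_wpmul2l _ (hC w Dw))); first by rewrite lee_fin.
by rewrite -!EFinM lee_fin mulrCA [psi w * _]mulrC.
Qed.

End integral_operators.

(** * Size and measurability of the Bergman projection *)

Section bergman_projection.
Variable R : realType.
Implicit Types z w : C2 R.

Local Notation k z w := (normc (bergman_kernel R z w)).

(** The factor 2 arises because the real and imaginary parts of the integral are each bounded by the
    same integral of moduli. *)
Lemma normc_proj_le (f : C2 R -> R[i]) z : cmeasurable f ->
  ((normc (bergman_proj R f z))%:E <=
     2%:E * \int[vol4 R]_(w in Hartogs R) (k z w * normc (f w))%:E)%E.
Proof.
move=> mf; have mH := @measurable_Hartogs R.
have [m1 m2] : cmeasurable (fun w => bergman_kernel R z w * f w).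
  have mz : measurable_fun setT (fun w : C2 R => (z, w)).
    by apply: measurable_fun_pair; meas.
  exact: (cmeasurableM (cmeasurable_comp (@cmeasurable_kernel R) mz) mf).
have h (c d : R) : normc (c +i* d) <= `|c| + `|d|.
  rewrite -(ler_pXn2r (n := 2))// ?nnegrE ?sqrtr_ge0 ?addr_ge0//.
  rewrite sqr_sqrtr ?addr_ge0 ?sqr_ge0// sqrrD !real_normK ?num_real//.
  by rewrite lerD2r lerDl mulrn_wge0// mulr_ge0.
apply: (@le_trans _ _ ((`|Rintegral (vol4 R) (Hartogs R)
      (fun w => complex.Re (bergman_kernel R z w * f w))|)%:E
   + (`|Rintegral (vol4 R) (Hartogs R)
      (fun w => complex.Im (bergman_kernel R z w * f w))|)%:E)%E).
  by rewrite -EFinD lee_fin; exact: h.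
rewrite (_ : 2%:E = 1 + 1)%E; last by rewrite -EFinD.
rewrite ge0_muleDl ?lee_fin// !mul1e; apply: leeD.
  apply: (le_trans (le_abs_Rintegral _ mH (measurable_funTS m1))).
  apply: le_lower_integral => w _; rewrite lee_fin//.
  by rewrite -normcM; exact: Re_le_normc.
apply: (le_trans (le_abs_Rintegral _ mH (measurable_funTS m2))).
apply: le_lower_integral => w _; rewrite lee_fin//.
by rewrite -normcM; exact: Im_le_normc.
Qed.

(** As [f] vanishes off the triangle, the integral may be taken over the whole space, where the
    measurability of sections applies to the jointly measurable kernel. *)
Lemma measurable_proj (f : C2 R -> R[i]) : cmeasurable f ->
  (forall w, ~ Hartogs R w -> f w = 0) -> cmeasurable (bergman_proj R f).
Proof.
move=> mf f0.
have [m1 m2] : cmeasurable (fun p : C2 R * C2 R => bergman_kernel R p.1 p.2 * f p.2).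
  apply: cmeasurableM; first exact: cmeasurable_kernel.
  exact: (cmeasurable_comp mf measurable_snd).
have e (P : R[i] -> R) z : P 0 = 0 ->
    Rintegral (vol4 R) (Hartogs R) (fun w => P (bergman_kernel R z w * f w)) =
    Rintegral (vol4 R) setT (fun w => P (bergman_kernel R z w * f w)).
  move=> P0; rewrite /Rintegral integral_mkcond; congr fine; apply: eq_integral => w _.
  rewrite patchE; case: ifPn => //; rewrite notin_setE => /f0 ->.
  by rewrite mulr0 P0.
split.
  apply: eq_measurable_fun (measurable_Rintegral_section (vol R) m1) => z _.
  exact: esym (e (@complex.Re R) z erefl).
apply: eq_measurable_fun (measurable_Rintegral_section (vol R) m2) => z _.
exact: esym (e (@complex.Im R) z erefl).
Qed.

End bergman_projection.

Unset Implicit Arguments.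

Theorem theorem4p9 (R : realType) (j : nat) (alpha : R) :
  (1 <= j)%N -> alpha < -1 ->
  exists C : R, 0 < C /\
    forall f : C2 R -> R[i],
      measurable_fun (Hartogs R) (fun w => complex.Re (f w)) ->
      measurable_fun (Hartogs R) (fun w => complex.Im (f w)) ->
      (wnorm43 R alpha j f < +oo)%E ->
      forall lambda : R, 0 < lambda ->
        (vol4 R [set z | Hartogs R z /\ (lambda < normc (bergman_proj R f z))%R]
          <= C%:E * wnorm43 R alpha j f * ((lambda `^ (4%:R / 3%:R))^-1)%:E)%E.
Proof.
case: j => // j _ al.
(* Any exponent [a] in []0, 1[] would do here; the second one is then forced to be [a / 3] by
   [gweight_mu]. *)
have a0 : (0 : R) < 1 / 2 by lra.
have a1 : (1 / 2 : R) < 1 by lra.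
have b0 : (0 : R) < 1 / 2 / 3%:R by lra.
have b1 : (1 / 2 / 3%:R : R) < 1 by lra.
have [K1 [K10 hK1]] := schur_falpha j al a0 a1.
have [K2 [K20 hK2]] := schur_gweight b0 b1.
move: b0 b1 hK2; set b := 1 / 2 / 3%:R => b0 b1 hK2.
pose K3 := 4 * (4 * K1) `^ (1 / 3%:R).
have K30 : 0 < K3 by apply: mulr_gt0 => //; apply: powR_gt0; exact: mulr_gt0.
exists (K3 * K2); split; first exact: mulr_gt0.
move=> f mRe mIm _ lambda l0.
have mH := @measurable_Hartogs R.
(* [f] is measurable only on the triangle; its extension by zero is measurable everywhere and has
   the same projection. *)
pose g (w : C2 R) : R[i] := ((fun w => complex.Re (f w)) \_ (Hartogs R)) w +i*
                         ((fun w => complex.Im (f w)) \_ (Hartogs R)) w.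
have mg : cmeasurable g.
  by apply: cmeasurable_pair; apply/(measurable_restrictT _ mH).
have gE w : Hartogs R w -> g w = f w.
  by move=> Hw; rewrite /g !patchE (mem_set Hw); case: (f w).
have g0 w : ~ Hartogs R w -> g w = 0.
  by move=> Hw; rewrite /g !patchE (memNset Hw).
have PE z : bergman_proj R f z = bergman_proj R g z.
  rewrite /bergman_proj /cintegral; congr (_ +i* _); congr fine;
    by apply: eq_integral => w; rewrite inE => Hw; rewrite gE.
have mP := measurable_normc (measurable_proj mg g0).
set A := [set z | _].
have AE : A = Hartogs R `&` [set z | cst lambda z < normc (bergman_proj R g z)].
  rewrite /A; under [in LHS]eq_set do rewrite PE.
  by [].
have mA : measurable A.
  by rewrite AE; apply: measurableI => //; apply: measurable_set_lt.
pose U (w : C2 R) := gweight (1 / 2) w * falpha R alpha j.+1 (z2 R w).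
have U0 w : Hartogs R w -> 0 < U w.
  move=> Hw; have /andP[w12 w21] := Hw; apply: mulr_gt0; first exact: gweight_gt0.
  by apply: falpha_gt0 => //; rewrite (le_lt_trans _ w12) ?normc_ge0.
have mU : measurable_fun setT U.
  apply: measurable_funM; first exact: measurable_gweight.
  exact: measurable_falpha (@cmeasurable_z2 R).
pose psi (w : C2 R) := U w `^ (- (1 / 3%:R)) * normc (g w) `^ (4%:R / 3%:R).
have psi0 w : 0 <= psi w by apply: mulr_ge0; exact: powR_ge0.
have mpsi : measurable_fun setT psi.
  by apply: measurable_funM; apply: measurable_fun_powR => //; exact: measurable_normc.
(* The constant of [pointwise_bound] is absorbed into the function to which [schur_tonelli] is
   applied. *)
pose psi1 w := K3 * psi w.
have psi10 w : 0 <= psi1 w by apply: mulr_ge0; [exact: ltW|exact: psi0].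
have mpsi1 : measurable_fun setT psi1 by exact: measurable_funM.
have mk z : measurable_fun (Hartogs R) (fun w => (normc (bergman_kernel R z w) * psi w)%:E).
  apply/measurable_EFinP; apply: measurable_funTS; apply: measurable_funM mpsi.
  exact: measurable_kernel_norm1.
have wE : (\int[vol4 R]_(w in Hartogs R) (gweight b w * psi1 w)%:E =
    K3%:E * wnorm43 R alpha j.+1 f)%E.
  have -> : wnorm43 R alpha j.+1 f =
      (\int[vol4 R]_(w in Hartogs R) (gweight b w * psi w)%:E)%E.
    apply: eq_integral => w; rewrite inE => Hw.
    by rewrite /psi mulrA gweight_mu// gE// mulrC.
  rewrite -ge0_integralZl_EFin; [|exact: mH| | |exact: ltW]; last 2 first.
  - move=> w Hw; rewrite lee_fin; apply: mulr_ge0; [exact: ltW (gweight_gt0 b Hw)|exact: psi0].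
  - apply/measurable_EFinP; apply: measurable_funTS; apply: measurable_funM mpsi.
    exact: measurable_gweight.
  by apply: eq_integral => w _; rewrite -EFinM /psi1 mulrCA.
(* [pointwise_bound] with [V = gweight (1 / 2) z]; the resulting [V^(1/3)] is then replaced by the
   test function [gweight b z]. *)
have step z : Hartogs R z -> lambda < normc (bergman_proj R g z) ->
    ((lambda `^ (4%:R / 3%:R))%:E <= (gweight b z)%:E *
      \int[vol4 R]_(w in Hartogs R) (normc (bergman_kernel R z w) * psi1 w)%:E)%E.
  move=> Hz lz.
  have V0 := gweight_gt0 (1 / 2) Hz.
  have hl : (lambda%:E < 2%:E * \int[vol4 R]_(w in Hartogs R)
       (normc (bergman_kernel R z w) * normc (g w))%:E)%E.
    by apply: lt_le_trans (normc_proj_le z mg); rewrite lte_fin.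
  have h := pointwise_bound K10 l0 V0 U0 mU (fun w => normc_ge0 _ (g w))
    (measurable_normc mg) (hK1 z Hz) hl.
  have -> : (\int[vol4 R]_(w in Hartogs R) (normc (bergman_kernel R z w) * psi1 w)%:E =
     K3%:E * \int[vol4 R]_(w in Hartogs R) (normc (bergman_kernel R z w) * psi w)%:E)%E.
    rewrite -ge0_integralZl_EFin; [|exact: mH| |exact: mk|exact: ltW].
      by apply: eq_integral => w _; rewrite -EFinM /psi1 mulrCA.
    by move=> w _; rewrite lee_fin; apply: mulr_ge0; [exact: normc_ge0|exact: psi0].
  apply: (le_trans h); rewrite [leRHS]muleCA; apply: lee_wpmul2l.
    by rewrite lee_fin ltW.
  apply: lee_wpmul2r; last by rewrite lee_fin; exact: gweight_root.
  by apply: integral_ge0 => w _; rewrite lee_fin; apply: mulr_ge0; [exact: normc_ge0|exact: psi0].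
have T0 z w : 0 <= normc (bergman_kernel R z w) by exact: normc_ge0.
have hK w : Hartogs R w -> (\int[vol4 R]_(z in Hartogs R)
    (normc (bergman_kernel R z w) * gweight b z)%:E <= (K2 * gweight b w)%:E)%E.
  move=> Hw; apply: (le_trans _ (hK2 w Hw)).
  apply: le_lower_integral => z Hz; last by rewrite (normc_kernelC z w).
  by rewrite lee_fin; apply: mulr_ge0; [exact: normc_ge0|exact: ltW (gweight_gt0 b Hz)].
(* A Chebyshev argument: the left side is the integral of a constant over [A], where [step] bounds
   that constant by the integrand of [schur_tonelli]. *)
have key : ((lambda `^ (4%:R / 3%:R))%:E * vol4 R A <= (K3 * K2)%:E * wnorm43 R alpha j.+1 f)%E.
  rewrite -(integral_cst (vol4 R) mA (lambda `^ (4%:R / 3%:R))%:E).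
  rewrite [(K3 * K2)%R]mulrC EFinM -muleA -wE.
  have T : (\int[vol4 R]_(z in Hartogs R) ((gweight b z)%:E *
      \int[vol4 R]_(w in Hartogs R) (normc (bergman_kernel R z w) * psi1 w)%:E)
     <= K2%:E * \int[vol4 R]_(w in Hartogs R) (gweight b w * psi1 w)%:E)%E.
    exact: (@schur_tonelli R _ _ (vol R) (Hartogs R)
      (fun z w => normc (bergman_kernel R z w)) (gweight b) psi1 K2 mH
      (@measurable_kernel_norm R) T0 (fun z Hz => ltW (gweight_gt0 b Hz))
      (measurable_gweight b) hK (ltW K20) psi10 mpsi1).
  apply: (le_trans _ T).
  rewrite integral_mkcond [leRHS]integral_mkcond; apply: le_lower_integral => z _.
    by apply: erestrict_ge0 => y _; rewrite lee_fin powR_ge0.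
  rewrite !patchE; case: ifPn => [|_].
    rewrite inE AE => -[Hz lz]; rewrite (mem_set Hz).
    exact: step.
  case: ifPn => //; rewrite inE => Hz; apply: mule_ge0.
    by rewrite lee_fin; exact: ltW (gweight_gt0 b Hz).
  by apply: integral_ge0 => w _; rewrite lee_fin; apply: mulr_ge0; [exact: normc_ge0|exact: psi10].
by rewrite lee_pdivlMr ?powR_gt0// muleC.
Qed.
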